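(* Consider the setting in which there is a bound $M_f$ on the hitting costs and the action space has bounded diameter $M_s$. The algorithm ACORD (defined in the context), run with the number of inner iterations in round $t$ equal to $$K_t=\frac{\log\left(\dfrac{T^4\cdot 128\cdot\beta l N\,(M_f+M_s^2/2)\,\max_i(\mu_i+\lambda_1^i)}{(\sigma_t\min_i\lambda_1^i)^2}\right)}{\log\left(\dfrac{4\beta l}{4\beta l-\sigma_t}\right)}=\mathcal O(\log T),$$ guarantees the following performance for any $T>0$: $$\mathrm{Cost}_{\mathrm{ACORD}}[1,T]\;\le\;\underbrace{\left(\frac{\mathrm{CR}_*+1/2T^2}{1-1/2T^2}\right)}_{\mathrm{CR}_{\mathrm{ACORD}}}\mathrm{Cost}_{\mathrm{OPT}}[1,T]+\frac{1+\beta\,(m^2/l)}{4T},$$ where $1/2T^2$ means $\frac{1}{2T^2}$ and $$\mathrm{CR}_*=\frac12+\frac12\sqrt{1+\frac{4}{\min_i\mu_i}}.$$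
   Context: Problem. There are $N$ agents $[N]=\{1,\dots,N\}$ and a finite horizon of rounds $t=1,\dots,T$. In round $t$ agent $i$ receives online a $\mu_i$-strongly convex hitting cost $f_t^i$ and takes an action $x_t^i\in\mathbb{R}^d$. In round $t$ the agents are coupled through an undirected graph $\mathcal G_t=([N],\mathcal E_t)$, which may change adaptively and adversarially across rounds and is not necessarily connected. Each edge $e=(i,j)\in\mathcal E_t$ carries a matrix $A_t^{e}=A_t^{(i,j)}\in\mathbb{R}^{r_t\times d}$, $r_t\ge d$, of full rank with singular values in $[\sqrt m,\sqrt l]$; $\beta\ge 0$ is the dissimilarity weight. With $\mathbf x_t=(x_t^1,\dots,x_t^N)$, the cumulative cost of a sequence of actions is $$\mathrm{Cost}[1,T]=\sum_{t=1}^T\Big\{\sum_{i=1}^N\big(f_t^i(x_t^i)+\tfrac12\|x_t^i-x_{t-1}^i\|_2^2\big)+\tfrac{\beta}{2}\sum_{(i,j)\in\mathcal E_t}\|A_t^{(i,j)}x_t^i-A_t^{(i,j)}x_t^j\|_2^2\Big\}.$$ OPT is the hindsight optimal sequence, which minimizes this cumulative cost offline. Parameters. $\lambda_1^i=\dfrac{2}{1+\sqrt{1+4/\mu_i}}$ for each $i$. The number $\sigma_t$, a function of the strong convexity parameters $\mu_1,\dots,\mu_N$, $\beta$ and the graph $\mathcal G_t$, is the strong convexity parameter, jointly in $(\mathbf x,\mathbf z)$ with $\mathbf x=(x^i)_{i=1}^N$ and $\mathbf z=(z_e)_{e\in\mathcal E_t}$, of $$\mathbb F_t(\mathbf x,\mathbf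 z)=\sum_{i=1}^N\Big\{f_t^i(x^i)+\tfrac{\lambda_1^i}{2}\|x^i-x_{t-1}^i\|_2^2+\beta\sum_{\mathcal E_t\ni e\ni i}\|A_t^e x^i-A_t^e z_e\|_2^2\Big\};$$ it is taken to be the smallest eigenvalue of the quadratic form $\sum_i(\mu_i+\lambda_1^i)\|x^i\|_2^2+2\beta m\sum_i\sum_{\mathcal E_t\ni e\ni i}\|x^i-z_e\|_2^2$. ACORD. In round $t$, after receiving $f_t^1,\dots,f_t^N$, $\beta$ and $\{A_t^e\}_{e\in\mathcal E_t}$, start from initial values $(z_e)_0$, $e\in\mathcal E_t$ (a starting point chosen at the user's convenience). For $k=1,\dots,K_t$: each agent $i$ computes $$(x_t^i)_k=\arg\min_{x\in\mathbb{R}^d}\Big\{f_t^i(x)+\tfrac{\lambda_1^i}{2}\|x-x_{t-1}^i\|_2^2+\beta\sum_{\mathcal E_t\ni e\ni i}\|A_t^e x-A_t^e(z_e)_{k-1}\|_2^2\Big\},$$ and then for each edge $e=(i,j)\in\mathcal E_t$ one sets $(z_e)_k=\frac{(x_t^i)_k+(x_t^j)_k}{2}$. Finally $x_t^i=(x_t^i)_{K_t}$ for every $i$.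
   Formalization: The hitting costs are assumed nonnegative (with negative costs the ratio bound fails, e.g. f(x)=x²/2−1), and the initial values (z_e)_0 are assumed to lie in the action space; K_t is rounded up to an integer that is at least 1. *)

(* Defs.v *)
From HB Require Import structures.
From mathcomp Require Import all_boot all_order all_algebra.
From mathcomp Require Import all_classical all_reals all_analysis.

Set Implicit Arguments.
Unset Strict Implicit.
Unset Printing Implicit Defensive.

Import Order.TTheory GRing.Theory Num.Theory.
Import numFieldNormedType.Exports.

Local Open Scope classical_set_scope.
Local Open Scope ring_scope.

Section Euclidean.
Variable R : realType.

(* The norm `|x| that MathComp-Analysis puts on matrices is the sup norm;
   the Euclidean norm is needed here. *)
Definition norm2 (n : nat) (x : 'cV[R]_n) : R :=
  Num.sqrt (\sum_k x k 0 ^+ 2).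

Definition strongly_convex (d : nat) (D : set 'cV[R]_d) (mu : R)
    (f : 'cV[R]_d -> R) : Prop :=
  forall (x y : 'cV[R]_d) (s : R), D x -> D y -> 0 <= s <= 1 ->
    f (s *: x + (1 - s) *: y) <=
      s * f x + (1 - s) * f y - mu / 2 * (s * (1 - s)) * norm2 (x - y) ^+ 2.

Definition is_argmin (T : Type) (D : set T) (F : T -> R) (x : T) : Prop :=
  D x /\ forall y, D y -> F x <= F y.

(* For a matrix with at least as many rows as columns. *)
Definition singular_value (r d : nat) (A : 'M[R]_(r, d)) (s : R) : Prop :=
  0 <= s /\ eigenvalue (A^T *m A) (s ^+ 2).

(* Over a nonempty finite index set the range is finite, so that the infimum
   is the minimum and the supremum the maximum. *)
Definition fmin (I : finType) (F : I -> R) : R := inf (range F).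
Definition fmax (I : finType) (F : I -> R) : R := sup (range F).

(* The symmetric matrix of a quadratic form, by polarization. *)
Definition qform_mx (n : nat) (q : 'rV[R]_n -> R) : 'M[R]_n :=
  \matrix_(i, j)
    ((q (delta_mx 0 i + delta_mx 0 j) - q (delta_mx 0 i) - q (delta_mx 0 j)) / 2).

(* A matrix has finitely many eigenvalues: for n > 0 and M symmetric, this is
   an attained minimum. *)
Definition smallest_eigenvalue (n : nat) (M : 'M[R]_n) : R :=
  inf [set c : R | eigenvalue M c].

End Euclidean.

(* An undirected edge {i, j} is represented by the pair (i, j) with i < j. *)
Definition edge_set (N : nat) (E : {set 'I_N * 'I_N}) : Prop :=
  forall e, e \in E -> (e.1 < e.2)%N.

Definition incident (N : nat) (i : 'I_N) (e : 'I_N * 'I_N) : bool :=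
  (i == e.1) || (i == e.2).

Section Costs.
Variables (R : realType) (N d : nat).

Definition round_cost (beta : R) (r : nat) (f : 'I_N -> 'cV[R]_d -> R)
    (E : {set 'I_N * 'I_N}) (A : 'I_N * 'I_N -> 'M[R]_(r, d))
    (xprev x : 'I_N -> 'cV[R]_d) : R :=
  \sum_i (f i (x i) + 1 / 2 * norm2 (x i - xprev i) ^+ 2) +
  beta / 2 * \sum_(e in E) norm2 (A e *m x e.1 - A e *m x e.2) ^+ 2.

(* Rounds are numbered from 1; x 0 is the initial action profile. *)
Definition Cost (beta : R) (r : nat -> nat)
    (f : nat -> 'I_N -> 'cV[R]_d -> R) (E : nat -> {set 'I_N * 'I_N})
    (A : forall t, 'I_N * 'I_N -> 'M[R]_(r t, d)) (T : nat)
    (x : nat -> 'I_N -> 'cV[R]_d) : R :=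
  \sum_(1 <= t < T.+1) round_cost beta (f t) (E t) (@A t) (x t.-1) (x t).

Definition is_OPT (D : set 'cV[R]_d) (beta : R) (r : nat -> nat)
    (f : nat -> 'I_N -> 'cV[R]_d -> R) (E : nat -> {set 'I_N * 'I_N})
    (A : forall t, 'I_N * 'I_N -> 'M[R]_(r t, d)) (T : nat)
    (x0 : 'I_N -> 'cV[R]_d) (y : nat -> 'I_N -> 'cV[R]_d) : Prop :=
  is_argmin
    [set y' | y' 0%N = x0 /\ forall t i, (1 <= t <= T)%N -> D (y' t i)]
    (Cost beta f E A T) y.

End Costs.

Section Constants.
Variables (R : realType) (N d : nat).

Definition lambda1 (mu : R) : R := 2 / (1 + Num.sqrt (1 + 4 / mu)).

(* A vector w of length d * (N + #|E|) is read as a d x (N + #|E|) matrix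
   whose first N columns are the x^i and whose remaining columns are the z_e,
   the edge of the k-th one being the k-th element of E. *)
Definition joint_form (mu : 'I_N -> R) (beta m : R) (E : {set 'I_N * 'I_N})
    (w : 'rV[R]_(d * (N + #|E|))) : R :=
  let W : 'M[R]_(d, N + #|E|) := vec_mx w in
  let x i := col i (lsubmx W) in
  let z k := col k (rsubmx W) in
  \sum_i (mu i + lambda1 (mu i)) * norm2 (x i) ^+ 2 +
  2 * beta * m *
    \sum_i \sum_(k < #|E| | incident i (enum_val k)) norm2 (x i - z k) ^+ 2.

Definition sigma (mu : 'I_N -> R) (beta m : R) (E : {set 'I_N * 'I_N}) : R :=
  smallest_eigenvalue (qform_mx (@joint_form mu beta m E)).

Definition K_formula (mu : 'I_N -> R) (beta m l Mf Ms : R) (T : nat)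
    (E : {set 'I_N * 'I_N}) : R :=
  ln (T%:R ^+ 4 * 128 * beta * l * N%:R * (Mf + Ms ^+ 2 / 2)
        * fmax (fun i => mu i + lambda1 (mu i))
      / (sigma mu beta m E * fmin (fun i => lambda1 (mu i))) ^+ 2)
  / ln (4 * beta * l / (4 * beta * l - sigma mu beta m E)).

(* An iteration count is a positive integer: the real number given by the
   formula is rounded up, and at least one iteration is performed.  The latter
   also covers beta = 0 and the graph without edges, where the formula is not
   meaningful but one iteration is already exact. *)
Definition K_iter (mu : 'I_N -> R) (beta m l Mf Ms : R) (T : nat)
    (E : {set 'I_N * 'I_N}) : nat :=
  absz (Num.max 1 (Num.ceil (K_formula mu beta m l Mf Ms T E))).

Definition CR_star (mu : 'I_N -> R) : R :=
  1 / 2 + 1 / 2 * Num.sqrt (1 + 4 / fmin mu).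

Definition CR_ACORD (mu : 'I_N -> R) (T : nat) : R :=
  (CR_star mu + 1 / (2 * T%:R ^+ 2)) / (1 - 1 / (2 * T%:R ^+ 2)).

End Constants.
Arguments sigma {R N} d mu beta m E.
Arguments K_formula {R N} d mu beta m l Mf Ms T E.
Arguments K_iter {R N} d mu beta m l Mf Ms T E.

Section Algorithm.
Variables (R : realType) (N d : nat).

Definition local_objective (mu : 'I_N -> R) (beta : R) (r : nat)
    (f : 'I_N -> 'cV[R]_d -> R) (E : {set 'I_N * 'I_N})
    (A : 'I_N * 'I_N -> 'M[R]_(r, d)) (xprev : 'I_N -> 'cV[R]_d)
    (z : 'I_N * 'I_N -> 'cV[R]_d) (i : 'I_N) (x : 'cV[R]_d) : R :=
  f i x + lambda1 (mu i) / 2 * norm2 (x - xprev i) ^+ 2 +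
  beta * \sum_(e in E | incident i e) norm2 (A e *m x - A e *m z e) ^+ 2.

(* One round: xs k and zs k are the k-th inner iterates (xs 0 is unused),
   zs 0 is the starting point and x the resulting action profile. *)
Definition acord_round (D : set 'cV[R]_d) (mu : 'I_N -> R) (beta : R)
    (r : nat) (f : 'I_N -> 'cV[R]_d -> R) (E : {set 'I_N * 'I_N})
    (A : 'I_N * 'I_N -> 'M[R]_(r, d)) (K : nat) (xprev : 'I_N -> 'cV[R]_d)
    (xs : nat -> 'I_N -> 'cV[R]_d) (zs : nat -> 'I_N * 'I_N -> 'cV[R]_d)
    (x : 'I_N -> 'cV[R]_d) : Prop :=
  [/\ forall k i, (1 <= k <= K)%N ->
        is_argmin D (local_objective mu beta f E A xprev (zs k.-1) i) (xs k i),
      forall k e, (1 <= k <= K)%N -> e \in E ->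
        zs k e = (1 / 2) *: (xs k e.1 + xs k e.2)
    & forall i, x i = xs K i].

End Algorithm.

(* Main.v *)
Require Import Defs.
From HB Require Import structures.
From mathcomp Require Import all_boot all_order all_algebra.
From mathcomp Require Import all_classical all_reals all_analysis.
From mathcomp Require Import ring lra.
Import Order.TTheory GRing.Theory Num.Theory.
Import numFieldNormedType.Exports.
Local Open Scope classical_set_scope.
Local Open Scope ring_scope.

(** Fix a round t and let G be its objective after minimizing out the edge
    variables: hitting costs, proximal terms with weights lambda1 (mu i) / 2,
    and the dissimilarity cost.  If ACORD played the exact minimizer of G, then
    the strong convexity of G, the Young inequality
    lambda1 |a - b|^2 <= |a|^2 + (mu + lambda1) |b|^2 and the potential
    sum_i (mu i + lambda1 (mu i)) / 2 |x i - y i|^2 would give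
    G x + phi_t <= cost_t y + phi_(t-1), and dividing the telescoped sum by
    lam = min_i lambda1 (mu i) = 1 / CR_star would give the ratio CR_star.

    The inner loop only reaches a gap eps to the infimum of G.  Near-optimality
    of x tested at (1 - theta) x + theta y yields the same inequality with a
    loss of theta * phi_t + eps / theta ([near_optimal_potential]).  The first
    loss is absorbed by the hitting costs: by strong convexity and
    nonnegativity, lam * phi_t <= 2 sum_i (f x + f y)
    ([potential_le_hitting]), and the weight 1 / lam counts the hitting costs
    more than once ([round_cost_le_objective]).  The choice
    theta = lam / (4 T^2) produces the terms 1 / (2 T^2) of the ratio, and
    eps = O(lam^2 / T^4) makes the losses eps / theta sum up to O(1 / T).

    The gap ([round_gap]).  Alternating minimization is gradient descent on the
    function of the edge variables, preconditioned by the edge Hessian.  With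
    rho = 4 beta l / (4 beta l - sigma), the gap contracts by rho^2 per
    iteration and the squared distance to a target contracts by rho with the
    gap as a gain ([alternating_rate]); both follow from one three-point
    inequality.  With Q = rho^K this bounds the gap by
    (rho - 1) / (Q (Q - 1)) times half the initial squared distance to an almost
    optimal profile.  That distance is O(beta l N (Mf + Ms^2 / 2) / sigma),
    because sigma is the joint modulus of convexity and because
    max_i (mu i + lambda1 (mu i)) times the squared diameter of the action
    space is at most 8 (Mf + Ms^2 / 2): a strongly convex function bounded by
    Mf lives on a small set ([start_distance], [weighted_sq_diam]).  The number
    of iterations makes Q at least the argument of the logarithm in its
    formula.  If that argument is at least 10 then the gap is small enough.
    Otherwise Mf + Ms^2 / 2 is so small that the total cost of ACORD is itself
    below the additive term. *)

(** * Euclidean inner product and the smallest eigenvalue *)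

Definition dot {R : realType} {n : nat} (u v : 'cV[R]_n) : R :=
  \sum_k u k 0 * v k 0.

Section Dot.
Context {R : realType} {n : nat}.
Implicit Types (u v w : 'cV[R]_n) (a : R).

Lemma norm2_sq u : norm2 u ^+ 2 = dot u u.
Proof.
rewrite /norm2 sqr_sqrtr; first by apply: eq_bigr => k _; rewrite expr2.
by apply: sumr_ge0 => k _; exact: sqr_ge0.
Qed.

Lemma dotC u v : dot u v = dot v u.
Proof. by apply: eq_bigr => k _; rewrite mulrC. Qed.

Lemma dotDl u v w : dot (u + v) w = dot u w + dot v w.
Proof. by rewrite -big_split; apply: eq_bigr => k _; rewrite !mxE mulrDl. Qed.

Lemma dotZl a u w : dot (a *: u) w = a * dot u w.
Proof. by rewrite mulr_sumr; apply: eq_bigr => k _; rewrite !mxE mulrA. Qed.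

Lemma dotNl u w : dot (- u) w = - dot u w.
Proof. by rewrite -scaleN1r dotZl mulN1r. Qed.

Lemma dotDr u v w : dot w (u + v) = dot w u + dot w v.
Proof. by rewrite dotC dotDl !(dotC w). Qed.

Lemma dotZr a u w : dot w (a *: u) = a * dot w u.
Proof. by rewrite dotC dotZl dotC. Qed.

Lemma dotNr u w : dot w (- u) = - dot w u.
Proof. by rewrite dotC dotNl dotC. Qed.

Lemma dot0l w : dot 0 w = 0.
Proof. by rewrite -(scale0r w) dotZl mul0r. Qed.

Lemma dot_ge0 u : 0 <= dot u u.
Proof. by apply: sumr_ge0 => k _; rewrite -expr2 sqr_ge0. Qed.

Lemma dot_eq0 u : (dot u u == 0) = (u == 0).
Proof.
apply/eqP/eqP => [|->]; last by rewrite dot0l.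
move/eqP; rewrite psumr_eq0 => [/allP h|k _]; last by rewrite -expr2 sqr_ge0.
apply/matrixP => k j; rewrite (ord1 j) mxE.
by have /= := h k (mem_index_enum k); rewrite mulf_eq0 orbb => /eqP.
Qed.

Definition dotE := (dotDl, dotDr, dotNl, dotNr, dotZl, dotZr).

End Dot.

Lemma dot_mulmx {R : realType} {n p : nat} (A : 'M[R]_(p, n)) u v :
  dot u (A *m v) = dot (A^T *m u) v.
Proof.
rewrite /dot (eq_bigr (fun k => \sum_j u k 0 * A k j * v j 0)) => [|k _]; last first.
  by rewrite mxE mulr_sumr; apply: eq_bigr => j _; rewrite mulrA.
rewrite exchange_big; apply: eq_bigr => j _ /=.
by rewrite mxE mulr_suml; apply: eq_bigr => k _; rewrite !mxE (mulrC (u k 0)).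
Qed.

Lemma continuous_sum {R : realType} {n p : nat} (F : 'I_p -> 'rV[R]_n -> R) :
  (forall k, continuous (F k)) -> continuous (fun u => \sum_k F k u).
Proof. by move=> Fc; apply: continuous_big => [|k _]; [exact: add_continuous|]. Qed.

(** A minimizer of the quadratic form on the unit sphere exists by compactness,
    and is an eigenvector because the first variation of the form there is
    proportional to it. *)
Lemma min_rayleigh {R : realType} {n : nat} (M : 'M[R]_n) :
  (0 < n)%N -> M^T = M ->
  exists c (v : 'cV[R]_n), [/\ M *m v = c *: v, dot v v = 1
    & forall u, c * dot u u <= dot u (M *m u)].
Proof.
move=> n0 Msym.
pose q (u : 'rV[R]_n) := dot u^T (M *m u^T).
pose S : set 'rV[R]_n := [set u | dot u^T u^T = 1].
have ctr k : continuous (fun u : 'rV[R]_n => u^T k 0).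
  have -> : (fun u : 'rV[R]_n => u^T k 0) = (fun u => u 0 k).
    by apply/funext => u; rewrite mxE.
  exact: coord_continuous.
have cdot : continuous (fun u : 'rV[R]_n => dot u^T u^T).
  by apply: continuous_sum => k u; exact: (cvgM (ctr k u) (ctr k u)).
have cM k : continuous (fun u : 'rV[R]_n => (M *m u^T) k 0).
  have -> : (fun u : 'rV[R]_n => (M *m u^T) k 0) =
      (fun u => \sum_j M k j * u^T j 0) by apply/funext => u; rewrite mxE.
  apply: continuous_sum => j u.
  exact: (cvgM (@cvg_cst _ _ _ _ _) (ctr j u)).
have cq : continuous q.
  by apply: continuous_sum => k u; exact: (cvgM (ctr k u) (cM k u)).
have Scompact : compact S.
  apply: bounded_closed_compact; last first.
    have -> : S = (fun u : 'rV[R]_n => dot u^T u^T) @^-1` [set 1] by [].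
    by apply: preimage_closed => [u _|]; [exact: cdot|exact: closed_eq].
  exists 1; split=> // b b1 u Su /=.
  rewrite /Num.norm /= mx_normrE; apply/bigmax_leP; split=> [|/= ij _].
    by rewrite (le_trans _ (ltW b1)).
  apply: le_trans (ltW b1).
  rewrite -(@ler_pXn2r _ 2%N) ?nnegrE// expr1n real_normK ?num_real// -Su /dot.
  rewrite (bigD1 ij.2)//= !mxE (ord1 ij.1) expr2 lerDl.
  by apply: sumr_ge0 => k _; rewrite -expr2 sqr_ge0.
have S0 : S !=set0.
  exists (delta_mx 0 (Ordinal n0)); rewrite /S /= /dot (bigD1 (Ordinal n0))//=.
  rewrite !mxE !eqxx mulr1 big1 ?addr0// => k kn.
  by rewrite !mxE (negbTE kn) andbF mulr0.
have [v0 vS vmin] := EVT_min_rV S0 Scompact (continuous_subspaceT cq).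
pose v := v0^T; pose c := q v0.
have v1 : dot v v = 1 by rewrite inE in vS.
have cmin u : c * dot u u <= dot u (M *m u).
  have [->|u0] := eqVneq u 0; first by rewrite dot0l mulr0 dot0l.
  have uu : 0 < dot u u by rewrite lt_neqAle dot_ge0 eq_sym dot_eq0 u0.
  pose s := Num.sqrt (dot u u).
  have s0 : 0 < s by rewrite sqrtr_gt0.
  have ss : s * s = dot u u by rewrite -expr2 sqr_sqrtr// ltW.
  have := vmin (s^-1 *: u^T); rewrite inE /S /= -/c /q.
  rewrite linearZ/= trmxK -scalemxAr !dotE -ss => h.
  have /h : s^-1 * (s^-1 * (s * s)) = 1 by field; rewrite gt_eqF.
  by rewrite mulrA -invfM mulrC ler_pdivlMr ?mulr_gt0.
exists c, v; split => //.
pose g := M *m v - c *: v.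
have [/eqP|g0] := eqVneq g 0; first by rewrite subr_eq0 => /eqP.
have gg : 0 < dot g g by rewrite lt_neqAle dot_ge0 eq_sym dot_eq0 g0.
pose K := dot g (M *m g) - c * dot g g.
have K0 : 0 <= K by rewrite subr_ge0.
pose t := dot g g / (K + 1).
have t0 : 0 < t by rewrite divr_gt0// ltr_wpDl.

have cE : dot v (M *m v) = c by [].
have Mvg : dot v (M *m g) = dot g (M *m v) by rewrite dot_mulmx Msym dotC.
have gE : dot g (M *m v) = dot g g + c * dot v g.
  by rewrite {3}/g !dotE (dotC v); ring.
have KE : dot g (M *m g) = K + c * dot g g by rewrite /K; ring.
have tK : t * K <= dot g g.
  rewrite /t mulrAC ler_pdivrMr ?ltr_wpDl//.
  by rewrite ler_wpM2l ?ltW// ltrDl.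
clearbody t K g; have := cmin (v - t *: g); clear g0.
rewrite mulmxDr mulmxN -scalemxAr !dotE v1 cE Mvg gE KE (dotC g v) => h.
have tgg := mulr_gt0 t0 gg; have ttK := ler_wpM2l (ltW t0) tK.
exfalso; clear -h tgg ttK; lra.
Qed.

Lemma eigenvalue_dot {R : realType} {n : nat} (M : 'M[R]_n) a :
  M^T = M -> eigenvalue M a ->
  exists2 v : 'cV[R]_n, 0 < dot v v & dot v (M *m v) = a * dot v v.
Proof.
move=> Msym /eigenvalueP[v vM v0]; exists v^T.
  by rewrite lt_neqAle dot_ge0 eq_sym dot_eq0 trmx_eq0 v0.
have -> : M *m v^T = a *: v^T by rewrite -{1}Msym -trmx_mul vM linearZ.
by rewrite dotZr.
Qed.

Lemma col_eigenvalue {R : realType} {n : nat} (M : 'M[R]_n) a (v : 'cV[R]_n) :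
  M^T = M -> dot v v = 1 -> M *m v = a *: v -> eigenvalue M a.
Proof.
move=> Msym v1 Mv; apply/eigenvalueP; exists v^T.
  by rewrite -{1}Msym -trmx_mul Mv linearZ.
by rewrite trmx_eq0 -dot_eq0 v1 oner_eq0.
Qed.

Lemma smallest_eigenvalueP {R : realType} {n : nat} (M : 'M[R]_n) :
  (0 < n)%N -> M^T = M ->
  exists v : 'cV[R]_n, [/\ dot v v = 1, dot v (M *m v) = smallest_eigenvalue M
    & forall u, smallest_eigenvalue M * dot u u <= dot u (M *m u)].
Proof.
move=> n0 Msym; have [c [v [Mv v1 cmin]]] := min_rayleigh M n0 Msym.
have cev : eigenvalue M c by exact: col_eigenvalue Mv.
have clb : lbound [set a : R | eigenvalue M a] c.
  move=> a /= /(eigenvalue_dot M a Msym)[u u0 uE].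
  by have := cmin u; rewrite uE ler_pM2r.
have -> : smallest_eigenvalue M = c.
  apply/eqP; rewrite eq_le; apply/andP; split.
    by apply: ge_inf => //; exists c.
  by apply: lb_le_inf => //; exists c.
by exists v; split; rewrite // Mv dotZr v1 mulr1.
Qed.

(** The Rayleigh quotients of the Gram matrix and of its opposite are bounded
    by the extreme squared singular values. *)
Lemma singular_value_bounds {R : realType} {r d : nat} (A : 'M[R]_(r, d)) (m l : R) :
  0 < m -> m <= l ->
  (forall s, singular_value A s -> Num.sqrt m <= s <= Num.sqrt l) ->
  forall v, m * dot v v <= dot (A *m v) (A *m v) <= l * dot v v.
Proof.
move=> m0 ml As v.
have [d0|d0] := posnP d.
  have -> : v = 0 by apply/matrixP => i; have := ltn_ord i; rewrite {2}d0.
  by rewrite mulmx0 !dot0l !mulr0 lexx.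
pose M := A^T *m A.
have Msym : M^T = M by rewrite trmx_mul trmxK.
have ME u : dot u (M *m u) = dot (A *m u) (A *m u).
  by rewrite -mulmxA dot_mulmx trmxK.
have sv c : 0 <= c -> eigenvalue M c -> m <= c <= l.
  move=> c0 cev; have /As : singular_value A (Num.sqrt c).
    by split; rewrite ?sqrtr_ge0// sqr_sqrtr.
  have l0 : 0 <= l by rewrite ltW// (lt_le_trans m0).
  by move=> /andP[h1 h2]; rewrite -(ler_sqrt _ l0) h2 -(ler_sqrt _ c0) h1.
apply/andP; split.
  have [c [u [Mu u1 cmin]]] := min_rayleigh M d0 Msym.
  have c0 : 0 <= c by have := ME u; rewrite Mu dotZr u1 mulr1 => ->; exact: dot_ge0.
  have /andP[mc _] := sv c c0 (col_eigenvalue M c u Msym u1 Mu).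
  by rewrite -ME; apply: le_trans (cmin v); rewrite ler_wpM2r// dot_ge0.
have MNsym : (- M)^T = - M by rewrite linearN/= Msym.
have [c [u [Mu u1 cmin]]] := min_rayleigh (- M) d0 MNsym.
have Mu' : M *m u = (- c) *: u by rewrite scaleNr -Mu mulNmx opprK.
have c0 : 0 <= - c by have := ME u; rewrite Mu' dotZr u1 mulr1 => ->; exact: dot_ge0.
have /andP[_ cl] := sv _ c0 (col_eigenvalue M _ u Msym u1 Mu').
have := cmin v; rewrite mulNmx dotNr ME lerNr -mulNr => h.
by apply: le_trans h _; rewrite ler_wpM2r// dot_ge0.
Qed.

(** * The joint strong convexity parameter *)

Section QuadraticForm.
Context {R : realType} {n : nat}.
Implicit Types q : 'rV[R]_n -> R.

(** The polarization [qform_mx] is defined for every function, but represents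
    only these. *)
Definition is_quadratic q := forall v, dot v^T (qform_mx q *m v^T) = q v.

Lemma qform_mx_sym q : (qform_mx q)^T = qform_mx q.
Proof.
apply/matrixP => i j; rewrite !mxE (addrC (delta_mx 0 j)).
by congr (_ / _); rewrite addrAC.
Qed.

Lemma quadraticZ a q : is_quadratic q -> is_quadratic (fun v => a * q v).
Proof.
move=> hq v; rewrite -hq -dotZr scalemxAl; congr (dot _ (_ *m _)).
by apply/matrixP => i j; rewrite !mxE; ring.
Qed.

Lemma quadraticD q1 q2 :
  is_quadratic q1 -> is_quadratic q2 -> is_quadratic (fun v => q1 v + q2 v).
Proof.
move=> h1 h2 v; rewrite -h1 -h2 -dotDr -mulmxDl; congr (dot _ (_ *m _)).
by apply/matrixP => i j; rewrite !mxE; field.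
Qed.

Lemma quadratic_sum (I : finType) (P : pred I) (q : I -> 'rV[R]_n -> R) :
  (forall i, is_quadratic (q i)) -> is_quadratic (fun v => \sum_(i | P i) q i v).
Proof.
move=> hq; elim: (index_enum I) => [|i s IHs].
  rewrite (_ : (fun _ => _) = (fun=> 0)); last by apply/funext => v; rewrite big_nil.
  move=> v; rewrite (_ : qform_mx _ = 0) ?mul0mx; last first.
    by apply/matrixP => i j; rewrite !mxE !subr0 mul0r.
  by rewrite dotC dot0l.
rewrite (_ : (fun _ => _) = fun v =>
    if P i then q i v + \sum_(j <- s | P j) q j v else \sum_(j <- s | P j) q j v).
  by case: (P i) => //; exact: quadraticD.
by apply/funext => v; rewrite big_cons.
Qed.

Lemma quadratic_sq (f : 'rV[R]_n -> R) :
  (forall a u v, f (a *: u + v) = a * f u + f v) -> is_quadratic (fun v => f v * f v).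
Proof.
move=> hf; have f0 : f 0 = 0 by have := hf 1 0 0; rewrite scaler0 addr0; lra.
have fD u v : f (u + v) = f u + f v by rewrite -{1}(scale1r u) hf mul1r.
have fZ a u : f (a *: u) = a * f u by rewrite -[_ *: _]addr0 hf f0 addr0.
have fE v : f v = \sum_j v 0 j * f (delta_mx 0 j).
  rewrite {1}(row_sum_delta v).
  by apply: (big_ind2 (fun x y => f x = y)) => // x1 x2 y1 y2 <- <-; rewrite fD.
move=> v; rewrite {1}fE mulr_suml; apply: eq_bigr => i _.
rewrite !mxE -mulrA; congr (_ * _).
rewrite (fE v) mulr_sumr; apply: eq_bigr => j _.
by rewrite !mxE fD; field.
Qed.

Lemma quadratic_dot p (f : 'rV[R]_n -> 'cV[R]_p) :
  (forall a u v, f (a *: u + v) = a *: f u + f v) ->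
  is_quadratic (fun v => dot (f v) (f v)).
Proof.
move=> hf; apply: quadratic_sum => k; apply: quadratic_sq => a u v.
by rewrite hf !mxE.
Qed.

End QuadraticForm.

Lemma dot_mxvec {R : realType} {p n : nat} (w : 'rV[R]_(p * n)) :
  dot w^T w^T = \sum_j dot (col j (vec_mx w)) (col j (vec_mx w)).
Proof.
rewrite exchange_big pair_bigA /= /dot.
rewrite (reindex _ (curry_mxvec_bij _ _))/=.
by apply: eq_bigr => -[i j] _ /=; rewrite !mxE.
Qed.

Lemma sum_incident {R : realType} {N : nat} (e : 'I_N * 'I_N) (F : 'I_N -> R) :
  e.1 != e.2 -> \sum_(i | incident i e) F i = F e.1 + F e.2.
Proof.
move=> e12; rewrite (bigD1 e.1) ?/incident ?eqxx//=; congr (_ + _).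
apply: big_pred1 => i /=; case: eqVneq => [->|_]; last by rewrite andbT.
by rewrite andbF (negbTE e12).
Qed.

Lemma edge_neq {N : nat} (E : {set 'I_N * 'I_N}) e :
  edge_set E -> e \in E -> e.1 != e.2.
Proof. by move=> hE /hE; rewrite neq_ltn => ->. Qed.

Lemma sum_edge_incident {R : realType} {N : nat} (E : {set 'I_N * 'I_N})
    (F : 'I_N -> 'I_N * 'I_N -> R) : edge_set E ->
  \sum_i \sum_(e in E | incident i e) F i e = \sum_(e in E) (F e.1 e + F e.2 e).
Proof.
move=> hE; rewrite (exchange_big_dep (mem E))/= => [|i e _ /andP[]//].
apply: eq_bigr => e eE; rewrite -(sum_incident e (F^~ e)) ?(edge_neq _ _ hE)//.
by apply: eq_bigl => i; rewrite eE.
Qed.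

Section Sigma.
Context {R : realType} {N d : nat} (mu : 'I_N -> R) (beta m : R)
  (E : {set 'I_N * 'I_N}).
Hypothesis hE : edge_set E.

Let w i := mu i + lambda1 (mu i).
Let q (x : 'I_N -> 'cV[R]_d) (z : 'I_N * 'I_N -> 'cV[R]_d) :=
  \sum_i w i * dot (x i) (x i) +
  2 * beta * m * \sum_(e in E) (dot (x e.1 - z e) (x e.1 - z e) +
                                dot (x e.2 - z e) (x e.2 - z e)).

Lemma quadratic_joint_form : is_quadratic (@joint_form R N d mu beta m E).
Proof.
pose x i (v : 'rV[R]_(d * (N + #|E|))) : 'cV[R]_d := col i (lsubmx (vec_mx v)).
pose z k (v : 'rV[R]_(d * (N + #|E|))) : 'cV[R]_d := col k (rsubmx (vec_mx v)).
have -> : @joint_form R N d mu beta m E = fun v =>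
    \sum_i w i * dot (x i v) (x i v) + 2 * beta * m * \sum_i
      \sum_(k < #|E| | incident i (enum_val k)) dot (x i v - z k v) (x i v - z k v).
  apply/funext => v; congr (_ + _ * _).
    by apply: eq_bigr => i _; rewrite norm2_sq.
  by apply: eq_bigr => i _; apply: eq_bigr => k _; rewrite norm2_sq.
apply: quadraticD.
  apply: quadratic_sum => i; apply: quadraticZ; apply: (quadratic_dot _ (x i)).
  by move=> a u v; rewrite /x !linearP.
apply: quadraticZ; apply: quadratic_sum => i; apply: quadratic_sum => k.
apply: (quadratic_dot _ (fun v => x i v - z k v)) => a u v.
by apply/matrixP => j0 j1; rewrite !mxE; ring.
Qed.

(** Together with [joint_form_vec], this identifies vectors with pairs of an
    agent profile and edge variables. *)
Lemma joint_formE (v : 'rV[R]_(d * (N + #|E|))) :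
  exists x z, joint_form mu beta m v = q x z /\
    dot v^T v^T = \sum_i dot (x i) (x i) + \sum_(e in E) dot (z e) (z e).
Proof.
pose W : 'M[R]_(d, N + #|E|) := vec_mx v.
pose z e := \sum_(k < #|E| | enum_val k == e) col k (rsubmx W).
have zE k : z (enum_val k) = col k (rsubmx W).
  by rewrite /z (big_pred1 k)// => j; rewrite (inj_eq enum_val_inj).
exists (fun i => col i (lsubmx W)), z; split.
  rewrite /joint_form /q; congr (_ + _).
    by apply: eq_bigr => i _; rewrite norm2_sq.
  congr (_ * _); rewrite -(sum_edge_incident E
    (fun i e => dot (col i (lsubmx W) - z e) (col i (lsubmx W) - z e)) hE).
  apply: eq_bigr => i _; rewrite [RHS]big_mkcondr [RHS]big_enum_val [LHS]big_mkcond.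
  by apply: eq_bigr => k _ /=; rewrite norm2_sq zE.
rewrite dot_mxvec big_split_ord /=; congr (_ + _).
  apply: eq_bigr => i _; rewrite (_ : col _ W = col i (lsubmx W))//.
  by apply/matrixP => j k; rewrite !mxE.
rewrite [RHS]big_enum_val; apply: eq_bigr => k _; rewrite zE.
rewrite (_ : col _ W = col k (rsubmx W))//.
by apply/matrixP => j k'; rewrite !mxE.
Qed.

Lemma joint_form_vec x z :
  exists v : 'rV[R]_(d * (N + #|E|)), joint_form mu beta m v = q x z /\
    dot v^T v^T = \sum_i dot (x i) (x i) + \sum_(e in E) dot (z e) (z e).
Proof.
pose X : 'M[R]_(d, N) := \matrix_(k, i) x i k 0.
pose Z : 'M[R]_(d, #|E|) := \matrix_(k, e) z (enum_val e) k 0.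
have XE i : col i X = x i by apply/matrixP => k j; rewrite !mxE (ord1 j).
have ZE e : col e Z = z (enum_val e) by apply/matrixP => k j; rewrite !mxE (ord1 j).
exists (mxvec (row_mx X Z)); split.
  rewrite /joint_form /q mxvecK row_mxKl row_mxKr; congr (_ + _).
    by apply: eq_bigr => i _; rewrite norm2_sq XE.
  congr (_ * _); rewrite -(sum_edge_incident E
    (fun i e => dot (x i - z e) (x i - z e)) hE).
  apply: eq_bigr => i _; rewrite [RHS]big_mkcondr [RHS]big_enum_val [LHS]big_mkcond.
  by apply: eq_bigr => k _ /=; rewrite norm2_sq XE ZE.
rewrite dot_mxvec mxvecK big_split_ord /=; congr (_ + _).
  apply: eq_bigr => i _; rewrite (_ : col _ _ = x i)//.
  by apply/matrixP => j k; rewrite mxE row_mxEl mxE (ord1 k).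
rewrite [RHS]big_enum_val; apply: eq_bigr => k _.
rewrite (_ : col _ _ = z (enum_val k))//.
by apply/matrixP => j k'; rewrite mxE row_mxEr mxE (ord1 k').
Qed.

Lemma sigma_le (x : 'I_N -> 'cV[R]_d) (z : 'I_N * 'I_N -> 'cV[R]_d) :
  sigma d mu beta m E * (\sum_i dot (x i) (x i) + \sum_(e in E) dot (z e) (z e)) <=
  \sum_i (mu i + lambda1 (mu i)) * dot (x i) (x i) +
  2 * beta * m * \sum_(e in E) (dot (x e.1 - z e) (x e.1 - z e) +
                                dot (x e.2 - z e) (x e.2 - z e)).
Proof.
have [v [vq vv]] := joint_form_vec x z.
rewrite -[leRHS]/(q x z) -vq -vv.
have [n0|n0] := posnP (d * (N + #|E|)).
  have -> : v = 0 by apply/matrixP => i j; have := ltn_ord j; rewrite {2}n0.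
  rewrite linear0 dot0l mulr0 -(quadratic_joint_form 0) linear0.
  by rewrite mulmx0 dot0l.
have [u [_ _]] := smallest_eigenvalueP _ n0 (qform_mx_sym (@joint_form R N d mu beta m E)).
by move=> /(_ v^T); rewrite quadratic_joint_form.
Qed.

Lemma sigma_gt0 : (0 < N)%N -> (0 < d)%N -> (forall i, 0 < w i) -> 0 < beta ->
  0 < m -> 0 < sigma d mu beta m E.
Proof.
move=> N0 d0 w0 b0 m0.
have n0 : (0 < d * (N + #|E|))%N by rewrite muln_gt0 d0 addn_gt0 N0.
have [u [u1 uE _]] := smallest_eigenvalueP _ n0 (qform_mx_sym (@joint_form R N d mu beta m E)).
rewrite /sigma -uE -(trmxK u) quadratic_joint_form.
have [x [z [-> ]]] := joint_formE u^T.
rewrite trmxK u1 => xz.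
have A0 : 0 <= \sum_i w i * dot (x i) (x i).
  by apply: sumr_ge0 => i _; rewrite mulr_ge0 ?dot_ge0// ltW.
have B0 : 0 <= \sum_(e in E) (dot (x e.1 - z e) (x e.1 - z e) +
                                dot (x e.2 - z e) (x e.2 - z e)).
  by apply: sumr_ge0 => e _; rewrite addr_ge0 ?dot_ge0.
have bm : 0 < 2 * beta * m by rewrite !mulr_gt0.
rewrite lt_neqAle addr_ge0 ?(mulr_ge0 (ltW bm))// andbT eq_sym.
apply/negP; rewrite paddr_eq0 ?(mulr_ge0 (ltW bm))// => /andP[].
rewrite psumr_eq0 => [/allP A|i _]; last by rewrite mulr_ge0 ?dot_ge0// ltW.
rewrite mulf_eq0 gt_eqF//= psumr_eq0 => [/allP B|e _]; last first.
  by rewrite addr_ge0 ?dot_ge0.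
have x0 i : x i = 0.
  have /= := A i (mem_index_enum i); rewrite mulf_eq0 gt_eqF//= dot_eq0.
  by move/eqP.
have z0 e : e \in E -> z e = 0.
  move=> eE; have /implyP/(_ eE) := B e (mem_index_enum e).
  rewrite paddr_eq0 ?dot_ge0// => /andP[]; rewrite dot_eq0 x0 sub0r oppr_eq0.
  by move/eqP.
move: xz; rewrite !big1 ?addr0 => [/eqP|e /z0->|i _]; rewrite ?x0 ?dot0l//.
by rewrite oner_eq0.
Qed.

End Sigma.

(** * The constants *)

Section FiniteExtrema.
Context {R : realType} {I : finType} (F : I -> R).

Lemma fminP (i1 : I) : exists2 i0, fmin F = F i0 & forall i, F i0 <= F i.
Proof.
pose i0 := [arg min_(i < i1) F i]%O.
have i0min i : F i0 <= F i by rewrite /i0; case: arg_minP => // j _; exact.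
exists i0 => //; apply/eqP; rewrite eq_le; apply/andP; split.
  by apply: ge_inf; [exists (F i0) => _ [i _ <-]|exists i0].
by apply: lb_le_inf => [|_ [i _ <-]//]; exists (F i0), i0.
Qed.

Lemma fmaxP (i1 : I) : exists2 i0, fmax F = F i0 & forall i, F i <= F i0.
Proof.
pose i0 := [arg max_(i > i1) F i]%O.
have i0max i : F i <= F i0 by rewrite /i0; case: arg_maxP => // j _; exact.
exists i0 => //; apply/eqP; rewrite eq_le; apply/andP; split.
  by apply: ge_sup => [|_ [i _ <-]//]; exists (F i0), i0.
by apply: ub_le_sup; [exists (F i0) => _ [i _ <-]|exists i0].
Qed.

End FiniteExtrema.

Section Lambda1.
Context {R : realType}.
Implicit Types a b : R.

Lemma lambda1_gt0 a : 0 < lambda1 a.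
Proof. by rewrite divr_gt0// ltr_pwDl// sqrtr_ge0. Qed.

(** By this equation, a (|u|^2 + (a + lambda1 a) |v|^2 - lambda1 a |u - v|^2)
    is the perfect square |lambda1 a u + a v|^2. *)
Lemma lambda1_sq a : 0 < a -> lambda1 a ^+ 2 = a * (1 - lambda1 a).
Proof.
move=> a0; rewrite /lambda1; set s := Num.sqrt _.
have ss : s ^+ 2 = 1 + 4 / a by rewrite sqr_sqrtr// addr_ge0// divr_ge0// ltW.
have s1 : 1 + s != 0 by rewrite gt_eqF// ltr_pwDl// sqrtr_ge0.
have as4 : a * (s - 1) * (1 + s) = 4.
  by transitivity (a * (s ^+ 2 - 1)); [ring|rewrite ss; field; rewrite gt_eqF].
have -> : a * (1 - 2 / (1 + s)) = a * (s - 1) * (1 + s) / (1 + s) ^+ 2 by field.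
by rewrite as4; field.
Qed.

Lemma lambda1_le1 a : 0 < a -> lambda1 a <= 1.
Proof.
move=> a0; have := lambda1_sq a a0; have := sqr_ge0 (lambda1 a) => h e.
by move: h; rewrite e pmulr_rge0// subr_ge0.
Qed.

Lemma lambda1_weight a : 0 < a -> (a + lambda1 a) * lambda1 a = a.
Proof. by move=> a0; rewrite mulrDl -expr2 lambda1_sq//; ring. Qed.

Lemma lambda1_homo a b : 0 < a -> a <= b -> lambda1 a <= lambda1 b.
Proof.
move=> a0 ab; have b0 := lt_le_trans a0 ab.
have s0 c : 0 < 1 + Num.sqrt c :> R by rewrite ltr_pwDl// sqrtr_ge0.
rewrite /lambda1 ler_pM2l// lef_pV2 ?posrE//; apply: lerD => //.
rewrite ler_wsqrtr//; apply: lerD => //; rewrite ler_pM2l//.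
by rewrite lef_pV2 ?posrE.
Qed.

Lemma CR_starE N (mu : 'I_N -> R) : CR_star mu * lambda1 (fmin mu) = 1.
Proof.
rewrite /CR_star /lambda1; set s := Num.sqrt _; field.
by rewrite gt_eqF// ltr_pwDl// sqrtr_ge0.
Qed.

Lemma fmin_lambda1 N (mu : 'I_N -> R) : (0 < N)%N -> (forall i, 0 < mu i) ->
  fmin (fun i => lambda1 (mu i)) = lambda1 (fmin mu).
Proof.
move=> N0 mu0; have [i -> imin] := fminP mu (Ordinal N0).
have [j -> jmin] := fminP (fun i => lambda1 (mu i)) (Ordinal N0).
by apply/eqP; rewrite eq_le jmin lambda1_homo.
Qed.

End Lambda1.

(** * Bounds on the joint strong convexity parameter *)

Section SigmaBounds.
Context {R : realType} {N d : nat} (mu : 'I_N -> R) (beta m l wm : R)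
  (E : {set 'I_N * 'I_N}).
Hypotheses (hE : edge_set E) (d0 : (0 < d)%N) (mu0 : forall i, 0 < mu i)
  (b0 : 0 < beta) (m0 : 0 < m) (ml : m <= l)
  (hwm : forall i, mu i + lambda1 (mu i) <= wm) (E0 : (0 < #|E|)%N).

Let sg := sigma d mu beta m E.
Let V : {set 'I_N} := ([set e.1 | e in E] :|: [set e.2 | e in E])%SET.

Let cardV : (#|V| <= 2 * #|E|)%N.
Proof.
rewrite (leq_trans (leq_card_setU _ _))// mul2n -addnn.
by rewrite leq_add// leq_imset_card.
Qed.

(** The joint form is tested at a vector with a common value on all edges and
    another common value on all non-isolated agents. *)
Lemma sigma_test (xi : R) :
  sg * (#|V|%:R * xi ^+ 2 + #|E|%:R) <=
  #|V|%:R * wm * xi ^+ 2 + 4 * beta * l * #|E|%:R * (1 - xi) ^+ 2.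
Proof.
pose u : 'cV[R]_d := delta_mx (Ordinal d0) 0.
have u1 : dot u u = 1.
  rewrite /dot (bigD1 (Ordinal d0))//= !mxE !eqxx mulr1 big1 ?addr0// => k kn.
  by rewrite !mxE (negbTE kn) mulr0.
pose x (i : 'I_N) : 'cV[R]_d := if i \in V then xi *: u else 0.
have := sigma_le (d:=d) mu beta m E hE x (fun=> u); rewrite -/sg.
have -> : \sum_i dot (x i) (x i) = #|V|%:R * xi ^+ 2.
  rewrite -sum1_card natr_sum mulr_suml [RHS]big_mkcond; apply: eq_bigr => i _.
  by rewrite /x; case: ifP => _; rewrite ?dot0l// !dotE u1; ring.
have -> : \sum_(e in E) dot u u = #|E|%:R.
  by rewrite u1 -sum1_card natr_sum.
move=> h; apply: le_trans h _; apply: lerD.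
  rewrite -sum1_card natr_sum !mulr_suml [leRHS]big_mkcond; apply: ler_sum => i _.
  rewrite /x; case: ifP => _; rewrite ?dot0l ?mulr0// !dotE u1 mul1r !mulr1.
  by rewrite -expr2 ler_wpM2r// sqr_ge0.
have -> : \sum_(e in E) (dot (x e.1 - u) (x e.1 - u) + dot (x e.2 - u) (x e.2 - u))
    = #|E|%:R * (2 * (1 - xi) ^+ 2).
  rewrite -sum1_card natr_sum mulr_suml; apply: eq_bigr => e eE.
  have -> : x e.1 = xi *: u by rewrite /x inE imset_f.
  have -> : x e.2 = xi *: u by rewrite /x inE imset_f ?orbT.
  by rewrite !dotE u1; ring.
have -> : 2 * beta * m * (#|E|%:R * (2 * (1 - xi) ^+ 2)) =
  (4 * beta * #|E|%:R * (1 - xi) ^+ 2) * m by ring.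
have -> : 4 * beta * l * #|E|%:R * (1 - xi) ^+ 2 =
  (4 * beta * #|E|%:R * (1 - xi) ^+ 2) * l by ring.
rewrite ler_wpM2l//; apply: mulr_ge0 (sqr_ge0 _); apply: mulr_ge0 (ler0n _ _).
by rewrite mulr_ge0// ltW.
Qed.

(** The test value 1 compares sigma with the largest agent weight; the value
    c / (c + g), which minimizes g xi^2 + c (1 - xi)^2, separates sigma from
    c = 4 beta l. *)
Lemma sigma_bounds :
  [/\ 0 < sg, sg < 4 * beta * l, sg * #|E|%:R <= N%:R * wm
    & (3 + sg / (4 * beta * l - sg)) * sg <= 2 * wm].
Proof.
have N0 : (0 < N)%N.
  by case/card_gt0P: E0 => -[i j] _; exact: leq_ltn_trans (ltn_ord i).
have w0 i : 0 < mu i + lambda1 (mu i) by rewrite addr_gt0// lambda1_gt0.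
have sg0 : 0 < sg by exact: sigma_gt0.
have e0 : 0 < #|E|%:R :> R by rewrite ltr0n.
have wm0 : 0 < wm by rewrite (lt_le_trans (w0 (Ordinal N0))).
have nN : #|V|%:R <= N%:R :> R by rewrite ler_nat -[X in (_ <= X)%N]card_ord max_card.
have nE : #|V|%:R <= 2 * #|E|%:R :> R by rewrite -natrM ler_nat cardV.
have n0 : 0 <= #|V|%:R :> R by rewrite ler0n.
have c0 : 0 < 4 * beta * l by rewrite !mulr_gt0// (lt_le_trans m0).
have := sigma_test; move: nN nE n0 c0.
move: (#|V|%:R) (4 * beta * l) => n c nN nE n0 c0 test.
move: e0 nE test; move: (#|E|%:R) => e e0 nE test.
have t1 : sg * (n + e) <= n * wm by have := test 1; rewrite expr1n subrr; lra.
have n1 : 0 < n.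
  rewrite lt_neqAle n0 andbT; apply/eqP => n00.
  by have := mulr_gt0 sg0 e0; move: t1; rewrite -n00; lra.
have sw : 3 * sg <= 2 * wm.
  rewrite -(ler_pM2l n1); have := ler_wpM2l (ltW sg0) nE.
  move: t1; rewrite mulrDr; lra.
pose g := 2 * (wm - sg).
have g0 : 0 < g by rewrite /g; lra.
have t2 (xi : R) : sg <= g * xi ^+ 2 + c * (1 - xi) ^+ 2.
  rewrite -(ler_pM2l e0).
  have wsg : 0 <= wm - sg by lra.
  have := ler_wpM2r (sqr_ge0 xi) (ler_wpM2r wsg nE); have := test xi.
  rewrite /g; lra.
have t3 : sg * (c + g) <= g * c.
  have cg : 0 < c + g by rewrite addr_gt0.
  have := t2 (c / (c + g)); rewrite -ler_pdivlMr//.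
  suff -> : g * (c / (c + g)) ^+ 2 + c * (1 - c / (c + g)) ^+ 2 = g * c / (c + g) by [].
  by field; rewrite gt_eqF.
have sc : sg < c.
  have := mulr_gt0 sg0 c0 => sc0.
  by rewrite -subr_gt0 -(pmulr_rgt0 _ g0); lra.
split => //.
  by apply: le_trans (ler_wpM2r (ltW wm0) nN); have := mulr_gt0 sg0 n1; lra.
have cs : 0 < c - sg by rewrite subr_gt0.
rewrite -(ler_pM2r cs).
have -> : (3 + sg / (c - sg)) * sg * (c - sg) = (3 * (c - sg) + sg) * sg.
  by field; rewrite gt_eqF.
move: t3; rewrite /g; lra.
Qed.

End SigmaBounds.

(** * One round: alternating minimization *)

Lemma dot_convex {R : realType} {n : nat} (u v : 'cV[R]_n) s :
  dot (s *: u + (1 - s) *: v) (s *: u + (1 - s) *: v) =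
  s * dot u u + (1 - s) * dot v v - s * (1 - s) * dot (u - v) (u - v).
Proof. by rewrite !dotE (dotC v u); ring. Qed.

Lemma le_of_lt1_segment {R : realType} (a b c : R) :
  (forall s, 0 < s < 1 -> a + (1 - s) * b <= c) -> a + b <= c.
Proof.
move=> h; apply/ler_addgt0Pr => e e0.
pose s := e / (e + `|b| + 1).
have eb : 0 < e + `|b| + 1 by rewrite ltr_pwDr// addr_ge0// ltW.
have s0 : 0 < s by rewrite divr_gt0.
have s1 : s < 1 by rewrite ltr_pdivrMr// mul1r -addrA ltrDl ltr_pwDr.
have : s * b <= e.
  rewrite /s mulrAC ler_pdivrMr// ler_pM2l//.
  by rewrite (le_trans (ler_norm b))// -addrA addrCA lerDl addr_ge0// ltW.
have /h : 0 < s < 1 by rewrite s0.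
lra.
Qed.

Lemma convex_setE {R : realType} {d : nat} (D : set 'cV[R]_d) u v s :
  convex_set D -> D u -> D v -> 0 <= s <= 1 -> D (s *: u + (1 - s) *: v).
Proof.
move=> cD Du Dv s01.
pose i : {i01 R} := Itv01 (proj1 (andP s01)) (proj2 (andP s01)).
by have := cD u v i; rewrite !inE => /(_ Du Dv).
Qed.

Section EdgeDot.
Context {R : realType} {N d r : nat} (beta : R) (E : {set 'I_N * 'I_N})
  (A : 'I_N * 'I_N -> 'M[R]_(r, d)).
Implicit Types a b c : 'I_N * 'I_N -> 'cV[R]_d.

(** The Hessian with respect to the edge variables of the joint objective. *)
Definition edge_dot a b : R :=
  4 * beta * \sum_(e in E) dot (A e *m a e) (A e *m b e).

Lemma edge_dotC a b : edge_dot a b = edge_dot b a.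
Proof. by congr (_ * _); apply: eq_bigr => e _; rewrite dotC. Qed.

Lemma edge_dotDl a b c : edge_dot (a + b) c = edge_dot a c + edge_dot b c.
Proof.
rewrite -mulrDr -big_split; congr (_ * _); apply: eq_bigr => e _ /=.
by rewrite mulmxDr dotDl.
Qed.

Lemma edge_dotZl k a c : edge_dot (k *: a) c = k * edge_dot a c.
Proof.
rewrite mulrCA mulr_sumr; congr (_ * _); apply: eq_bigr => e _ /=.
by rewrite -scalemxAr dotZl.
Qed.

Lemma edge_dotNl a c : edge_dot (- a) c = - edge_dot a c.
Proof. by rewrite -scaleN1r edge_dotZl mulN1r. Qed.

Lemma edge_dotDr a b c : edge_dot c (a + b) = edge_dot c a + edge_dot c b.
Proof. by rewrite edge_dotC edge_dotDl !(edge_dotC c). Qed.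

Lemma edge_dotNr a c : edge_dot c (- a) = - edge_dot c a.
Proof. by rewrite edge_dotC edge_dotNl edge_dotC. Qed.

Lemma edge_dotZr k a c : edge_dot c (k *: a) = k * edge_dot c a.
Proof. by rewrite edge_dotC edge_dotZl edge_dotC. Qed.

Definition edge_dotE :=
  (edge_dotDl, edge_dotDr, edge_dotNl, edge_dotNr, edge_dotZl, edge_dotZr).

Lemma edge_dot_ge0 a : 0 <= beta -> 0 <= edge_dot a a.
Proof.
move=> b0; rewrite mulr_ge0 ?mulr_ge0//.
by apply: sumr_ge0 => e _; exact: dot_ge0.
Qed.

(** Alternating minimization is a gradient method, preconditioned by the edge
    Hessian, on the function of the edge variables left after minimizing over
    the agents.  The first hypothesis compares an iterate with a fixed target
    and the second one with its predecessor.  With rho = 1 + eta, the second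
    makes the gap g k - gu decrease by the factor rho ^+ 2; the first makes
    the squared distance to the target decrease by the factor rho with the gap
    as a gain.  Summing the gains instead of using the distance alone is what
    puts eta in the numerator of the final bound on the gap. *)
Lemma alternating_rate (eta : R) (K : nat) (g : nat -> R) gu
    (z : nat -> 'I_N * 'I_N -> 'cV[R]_d) zu :
  0 <= beta -> 0 < eta ->
  (forall k, (k < K)%N ->
    g k.+1 + eta / 2 * edge_dot (zu - z k.+1) (zu - z k.+1) +
      edge_dot (z k - z k.+1) (zu - z k.+1) <= gu) ->
  (forall k, (0 < k < K)%N ->
    g k.+1 + eta / 2 * edge_dot (z k - z k.+1) (z k - z k.+1) +
      edge_dot (z k - z k.+1) (z k - z k.+1) <= g k) ->
  (g K - gu) * ((1 + eta) ^+ K * ((1 + eta) ^+ K - 1) / eta) <=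
    1 / 2 * edge_dot (z 0%N - zu) (z 0%N - zu).
Proof.
move=> b0 eta0 tgt prv.
pose s k := 1 / 2 * edge_dot (z k - zu) (z k - zu).
pose rho := 1 + eta; have rho0 : 0 < rho by rewrite addr_gt0.
have s0 k : 0 <= s k by rewrite mulr_ge0 ?edge_dot_ge0.
suff claim k : (k <= K)%N ->
    (g k - gu) * (rho ^+ k * (rho ^+ k - 1) / eta) + rho ^+ k * s k <= s 0%N.
  apply: le_trans (claim K (leqnn K)); rewrite lerDl mulr_ge0//.
  by rewrite exprn_ge0// ltW.
elim: k => [_|k IH kK].
  by rewrite expr0 subrr mulr0 mul0r mulr0 add0r mul1r.
have gain : rho * (g k.+1 - gu) + rho * s k.+1 <= s k.
  have := edge_dot_ge0 (rho *: (z k.+1 - zu) - (z k - zu)) b0.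
  have := tgt k kK; rewrite /s /rho.
  rewrite (_ : zu - z k.+1 = - (z k.+1 - zu)); last by rewrite opprB.
  rewrite (_ : z k - z k.+1 = (z k - zu) - (z k.+1 - zu)); last by rewrite opprB addrA subrK.
  move: (z k.+1 - zu) (z k - zu) => a b; rewrite !edge_dotE (edge_dotC b a).
  move: (edge_dot a a) (edge_dot a b) (edge_dot b b) => aa ab bb h1 h2.
  have := ler_wpM2l (ltW rho0) h1; rewrite /rho; lra.
have decr : (rho ^+ k - 1) * (rho ^+ 2 * (g k.+1 - gu)) <= (rho ^+ k - 1) * (g k - gu).
  have [->|k0] := posnP k; first by rewrite expr0 subrr !mul0r.
  apply: ler_wpM2l.
    by rewrite subr_ge0 exprn_ege1// /rho lerDl ltW.
  have h := prv k; rewrite k0 kK in h; move: (h isT) (tgt k kK) => {h}.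
  move: (z k - z k.+1) (zu - z k.+1) => p q.
  have := edge_dot_ge0 (p + eta *: q) b0; rewrite !edge_dotE (edge_dotC q p).
  move: (edge_dot p p) (edge_dot p q) (edge_dot q q) => pp pq qq h1 h2 h3.
  have h4 : 2 * eta * (g k.+1 - gu) <= pp by have := ler_wpM2l (ltW eta0) h3; lra.
  have h5 : 0 <= 1 + eta / 2 by rewrite addr_ge0// divr_ge0// ltW.
  have := ler_wpM2l h5 h4; rewrite /rho; lra.
have F0 : 0 <= rho ^+ k by rewrite exprn_ge0// ltW.
have Fe : 0 <= rho ^+ k / eta by rewrite divr_ge0// ltW.
apply: le_trans (IH (ltnW kK)).
have := lerD (ler_wpM2l F0 gain) (ler_wpM2l Fe decr).
rewrite (exprS rho k); move: (rho ^+ k) => F.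
have -> : F * (rho * (g k.+1 - gu) + rho * s k.+1) +
    F / eta * ((F - 1) * (rho ^+ 2 * (g k.+1 - gu))) =
    (g k.+1 - gu) * (rho * F * (rho * F - 1) / eta) + rho * F * s k.+1.
  by rewrite /rho; field; rewrite gt_eqF.
have -> : F * s k + F / eta * ((F - 1) * (g k - gu)) =
  (g k - gu) * (F * (F - 1) / eta) + F * s k by ring.
by [].
Qed.

End EdgeDot.

Section Round.
Context {R : realType} {N d r : nat} (mu : 'I_N -> R) (beta : R)
  (f : 'I_N -> 'cV[R]_d -> R) (E : {set 'I_N * 'I_N})
  (A : 'I_N * 'I_N -> 'M[R]_(r, d)) (xprev : 'I_N -> 'cV[R]_d)
  (D : set 'cV[R]_d).
Implicit Types (u v x : 'I_N -> 'cV[R]_d) (z : 'I_N * 'I_N -> 'cV[R]_d).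

Definition midpoints v : 'I_N * 'I_N -> 'cV[R]_d :=
  fun e => (1 / 2) *: (v e.1 + v e.2).

(** The joint objective after minimization over the edge variables. *)
Definition round_objective v : R :=
  \sum_i (f i (v i) + lambda1 (mu i) / 2 * dot (v i - xprev i) (v i - xprev i)) +
  beta / 2 * \sum_(e in E) dot (A e *m (v e.1 - v e.2)) (A e *m (v e.1 - v e.2)).

(** A quadratic form whose half bounds from below the modulus of convexity of
    [round_objective]. *)
Definition curvature v : R :=
  \sum_i (mu i + lambda1 (mu i)) * dot (v i) (v i) +
  beta * \sum_(e in E) dot (A e *m (v e.1 - v e.2)) (A e *m (v e.1 - v e.2)).

Hypotheses (hE : edge_set E) (b0 : 0 <= beta) (mu0 : forall i, 0 < mu i)
  (cD : convex_set D) (fconv : forall i, strongly_convex D (mu i) (f i)).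

Lemma curvature_ge_diag v :
  \sum_i (mu i + lambda1 (mu i)) * dot (v i) (v i) <= curvature v.
Proof.
by rewrite lerDl mulr_ge0//; apply: sumr_ge0 => e _; exact: dot_ge0.
Qed.

Lemma curvature_ge0 v : 0 <= curvature v.
Proof.
apply: le_trans (curvature_ge_diag v); apply: sumr_ge0 => i _.
by rewrite mulr_ge0 ?dot_ge0// addr_ge0// ltW// lambda1_gt0.
Qed.

Lemma sum_local_objective z v :
  \sum_i local_objective mu beta f E A xprev z i (v i) =
  round_objective v +
  1 / 2 * edge_dot beta E A (z - midpoints v) (z - midpoints v).
Proof.
rewrite /local_objective big_split /= -mulr_sumr.
have -> : \sum_i \sum_(e in E | incident i e) norm2 (A e *m v i - A e *m z e) ^+ 2
    = \sum_i \sum_(e in E | incident i e) dot (A e *m (v i - z e)) (A e *m (v i - z e)).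
  apply: eq_bigr => i _; apply: eq_bigr => e _.
  by rewrite norm2_sq mulmxBr.
rewrite (sum_edge_incident E
  (fun i e => dot (A e *m (v i - z e)) (A e *m (v i - z e))) hE).
rewrite /round_objective -addrA; congr (_ + _).
  by apply: eq_bigr => i _; rewrite norm2_sq.
rewrite /edge_dot !mulr_sumr -big_split /=; apply: eq_bigr => e _.
rewrite /midpoints -[(z - _) e]/(z e - (1 / 2) *: (v e.1 + v e.2)).
rewrite !(mulmxDr, mulmxN) -scalemxAr mulmxDr !dotE.
move: (A e *m v e.1) (A e *m v e.2) (A e *m z e) => a b c.
by rewrite (dotC c a) (dotC c b) (dotC b a); field.
Qed.

(** The local objective has modulus mu + lambda1 from the hitting cost and the
    proximal term, and its coupling term is exactly quadratic. *)
Lemma local_argmin z i (x y : 'cV[R]_d) :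
  is_argmin D (local_objective mu beta f E A xprev z i) x -> D y ->
  local_objective mu beta f E A xprev z i x +
    ((mu i + lambda1 (mu i)) / 2 * dot (y - x) (y - x) +
     beta * \sum_(e in E | incident i e) dot (A e *m (y - x)) (A e *m (y - x)))
  <= local_objective mu beta f E A xprev z i y.
Proof.
move=> [Dx xmin] Dy; apply: le_of_lt1_segment => s /andP[s0 s1].
have s01 : 0 <= s <= 1 by rewrite !ltW.
have Dt := convex_setE D y x s cD Dy Dx s01.
have := xmin _ Dt; have := fconv i y x s Dy Dx s01.
rewrite /local_objective !norm2_sq.
have -> : s *: y + (1 - s) *: x - xprev i =
    s *: (y - xprev i) + (1 - s) *: (x - xprev i).
  by apply/matrixP => j k; rewrite !mxE; ring.
rewrite dot_convex.
have -> : y - xprev i - (x - xprev i) = y - x by rewrite opprB addrA subrK.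
have -> : \sum_(e in E | incident i e)
    norm2 (A e *m (s *: y + (1 - s) *: x) - A e *m z e) ^+ 2 =
  s * (\sum_(e in E | incident i e) norm2 (A e *m y - A e *m z e) ^+ 2) +
  (1 - s) * (\sum_(e in E | incident i e) norm2 (A e *m x - A e *m z e) ^+ 2) -
  s * (1 - s) * (\sum_(e in E | incident i e) dot (A e *m (y - x)) (A e *m (y - x))).
  rewrite !mulr_sumr -sumrN -!big_split /=; apply: eq_bigr => e _.
  rewrite !norm2_sq.
  have -> : A e *m (s *: y + (1 - s) *: x) - A e *m z e =
      s *: (A e *m y - A e *m z e) + (1 - s) *: (A e *m x - A e *m z e).
    rewrite mulmxDr -!scalemxAr; apply/matrixP => j k.
    by rewrite !mxE; ring.
  rewrite dot_convex mulmxBr.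
  by rewrite (_ : A e *m y - A e *m z e - _ = A e *m y - A e *m x)// opprB addrA subrK.
move: (\sum_(e in E | _) norm2 (A e *m y - _) ^+ 2) => Sy.
move: (\sum_(e in E | _) norm2 (A e *m x - _) ^+ 2) => Sx.
move: (\sum_(e in E | _) dot _ _) => Sd.
move: (f i _) (f i x) (f i y) (lambda1 (mu i)) (mu i) => ft fx fy la mui.
move: (dot (y - xprev i) _) (dot (x - xprev i) _) (dot (y - x) _) => dy dx dd.
by move=> h1 h2; rewrite -(ler_pM2l s0); lra.
Qed.

(** Because the two block updates are exact, their errors combine into a single
    cross term between the last move of the edge variables and the direction
    to the comparator. *)
Lemma three_point z x v :
  (forall i, is_argmin D (local_objective mu beta f E A xprev z i) (x i)) ->
  (forall i, D (v i)) ->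
  round_objective x + 1 / 2 * curvature (v - x) +
    edge_dot beta E A (z - midpoints x) (midpoints v - midpoints x)
  <= round_objective v.
Proof.
move=> xmin Dv.
have := ler_sum (index_enum 'I_N) (fun i (_ : true) =>
  local_argmin z i (x i) (v i) (xmin i) (Dv i)).
rewrite big_split /= !sum_local_objective big_split /= -mulr_sumr.
rewrite (sum_edge_incident E
  (fun i e => dot (A e *m (v i - x i)) (A e *m (v i - x i))) hE).
have -> : beta * \sum_(e in E)
    (dot (A e *m (v e.1 - x e.1)) (A e *m (v e.1 - x e.1)) +
     dot (A e *m (v e.2 - x e.2)) (A e *m (v e.2 - x e.2))) =
  1 / 2 * edge_dot beta E A (midpoints v - midpoints x) (midpoints v - midpoints x)
  + beta / 2 * \sum_(e in E) dot (A e *m ((v - x) e.1 - (v - x) e.2))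
                               (A e *m ((v - x) e.1 - (v - x) e.2)).
  rewrite /edge_dot !mulr_sumr -big_split /=; apply: eq_bigr => e _.
  have -> : (midpoints v - midpoints x) e =
      (1 / 2) *: ((v e.1 - x e.1) + (v e.2 - x e.2)).
    by apply/matrixP => j k; rewrite !mxE; ring.
  rewrite -[(v - x) e.1]/(v e.1 - x e.1) -[(v - x) e.2]/(v e.2 - x e.2).
  rewrite -scalemxAr (mulmxDr (A e) (v e.1 - x e.1)) (mulmxBr (A e) _ (v e.2 - x e.2)).
  move: (A e *m (v e.1 - x e.1)) (A e *m (v e.2 - x e.2)) => a b.
  by rewrite !dotE (dotC b a); field.
rewrite (_ : \sum_i (mu i + lambda1 (mu i)) / 2 * dot (v i - x i) (v i - x i) =
  1 / 2 * \sum_i (mu i + lambda1 (mu i)) * dot ((v - x) i) ((v - x) i)); last first.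
  by rewrite mulr_sumr; apply: eq_bigr => i _; rewrite -[(v - x) i]/(v i - x i); field.
rewrite /curvature.
have -> : z - midpoints v = (z - midpoints x) - (midpoints v - midpoints x).
  by rewrite opprB addrA subrK.
move: (z - midpoints x) (midpoints v - midpoints x) => p q.
rewrite !edge_dotE (edge_dotC beta E A q p).
lra.
Qed.

Lemma round_objective_convex u v s :
  (forall i, D (u i)) -> (forall i, D (v i)) -> 0 <= s <= 1 ->
  round_objective (s *: u + (1 - s) *: v) <=
  s * round_objective u + (1 - s) * round_objective v -
  1 / 2 * (s * (1 - s)) * curvature (u - v).
Proof.
move=> Du Dv s01; rewrite /round_objective /curvature.
have -> : \sum_(e in E) dot
    (A e *m ((s *: u + (1 - s) *: v) e.1 - (s *: u + (1 - s) *: v) e.2))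
    (A e *m ((s *: u + (1 - s) *: v) e.1 - (s *: u + (1 - s) *: v) e.2)) =
  s * (\sum_(e in E) dot (A e *m (u e.1 - u e.2)) (A e *m (u e.1 - u e.2))) +
  (1 - s) * (\sum_(e in E) dot (A e *m (v e.1 - v e.2)) (A e *m (v e.1 - v e.2))) -
  s * (1 - s) * (\sum_(e in E) dot (A e *m ((u - v) e.1 - (u - v) e.2))
                                 (A e *m ((u - v) e.1 - (u - v) e.2))).
  rewrite !mulr_sumr -sumrN -!big_split /=; apply: eq_bigr => e _.
  have -> : (s *: u + (1 - s) *: v) e.1 - (s *: u + (1 - s) *: v) e.2 =
      s *: (u e.1 - u e.2) + (1 - s) *: (v e.1 - v e.2).
    by apply/matrixP => j k; rewrite !mxE; ring.
  have -> : (u - v) e.1 - (u - v) e.2 = (u e.1 - u e.2) - (v e.1 - v e.2).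
    by apply/matrixP => j k; rewrite !mxE; ring.
  by rewrite mulmxDr -!scalemxAr dot_convex (mulmxBr _ (u e.1 - u e.2)).
have : \sum_i (f i ((s *: u + (1 - s) *: v) i) + lambda1 (mu i) / 2 *
      dot ((s *: u + (1 - s) *: v) i - xprev i) ((s *: u + (1 - s) *: v) i - xprev i))
    <= s * (\sum_i (f i (u i) + lambda1 (mu i) / 2 * dot (u i - xprev i) (u i - xprev i)))
    + (1 - s) * (\sum_i (f i (v i) + lambda1 (mu i) / 2 * dot (v i - xprev i) (v i - xprev i)))
    - 1 / 2 * (s * (1 - s)) *
      \sum_i (mu i + lambda1 (mu i)) * dot ((u - v) i) ((u - v) i).
  rewrite !mulr_sumr -sumrN -!big_split /=; apply: ler_sum => i _.
  have := fconv i (u i) (v i) s (Du i) (Dv i) s01; rewrite norm2_sq.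
  have -> : (s *: u + (1 - s) *: v) i - xprev i =
      s *: (u i - xprev i) + (1 - s) *: (v i - xprev i).
    by apply/matrixP => j k; rewrite !mxE; ring.
  rewrite dot_convex -[(s *: u + (1 - s) *: v) i]/(s *: u i + (1 - s) *: v i).
  have -> : u i - xprev i - (v i - xprev i) = u i - v i by rewrite opprB addrA subrK.
  rewrite -[(u - v) i]/(u i - v i); lra.
lra.
Qed.

End Round.

Lemma le_of_linear_slack {R : realType} (a b c : R) : 0 <= c ->
  (forall e, 0 < e -> a <= b + c * e) -> a <= b.
Proof.
move=> c0 h; apply/ler_addgt0Pr => e e0.
have c1 : 0 < c + 1 by rewrite ltr_wpDl.
apply: le_trans (h (e / (c + 1)) (divr_gt0 e0 c1)) _.
rewrite lerD2l mulrCA ger_pMr// ler_pdivrMr// mul1r lerDl//.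
Qed.

Section RoundGap.
Context {R : realType} {N d r : nat} (mu : 'I_N -> R) (beta m l : R)
  (f : 'I_N -> 'cV[R]_d -> R) (E : {set 'I_N * 'I_N})
  (A : 'I_N * 'I_N -> 'M[R]_(r, d)) (xprev : 'I_N -> 'cV[R]_d)
  (D X : set 'cV[R]_d) (Mf Ms : R).
Hypotheses (N0 : (0 < N)%N) (hE : edge_set E) (b0 : 0 <= beta)
  (m0 : 0 < m) (ml : m <= l) (mu0 : forall i, 0 < mu i)
  (hA : forall e v, e \in E ->
     m * dot v v <= dot (A e *m v) (A e *m v) <= l * dot v v)
  (cD : convex_set D) (XD : X `<=` D)
  (hMs : forall p q, X p -> X q -> norm2 (p - q) <= Ms)
  (fconv : forall i, strongly_convex D (mu i) (f i))
  (f0 : forall i p, D p -> 0 <= f i p) (fMf : forall i p, X p -> f i p <= Mf)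
  (Xprev : forall i, X (xprev i)).

Let sg := sigma d mu beta m E.
Let wm := fmax (fun i => mu i + lambda1 (mu i)).
Let M := Mf + Ms ^+ 2 / 2.
Let G := round_objective mu beta f E A xprev.
Let W := curvature mu beta E A.
Let ed := edge_dot beta E A.

Let w_le i : mu i + lambda1 (mu i) <= wm.
Proof.
by have [j jE jmax] := fmaxP (fun i => mu i + lambda1 (mu i)) i; rewrite /wm jE.
Qed.

Lemma sq_diam p q : X p -> X q -> dot (p - q) (p - q) <= Ms ^+ 2.
Proof.
move=> Xp Xq; rewrite -norm2_sq.
have pq0 : 0 <= norm2 (p - q) by exact: sqrtr_ge0.
by apply: lerXn2r (hMs _ _ Xp Xq); rewrite nnegrE// (le_trans pq0)// hMs.
Qed.

(** A strongly convex function with values in [0, Mf] cannot live on a large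
    set, so that the diameter of the action space is controlled by Mf as well
    as by Ms. *)
Lemma weighted_sq_diam p q : X p -> X q -> wm * dot (p - q) (p - q) <= 8 * M.
Proof.
move=> Xp Xq.
have [i wE _] := fmaxP (fun i => mu i + lambda1 (mu i)) (Ordinal N0).
have h01 : 0 <= (1 / 2 : R) <= 1 by lra.
have := fconv i p q _ (XD _ Xp) (XD _ Xq) h01; rewrite norm2_sq.
have := f0 i _ (convex_setE D p q _ cD (XD _ Xp) (XD _ Xq) h01).
have := fMf i p Xp; have := fMf i q Xq; have := sq_diam _ _ Xp Xq.
rewrite /wm wE /M; have := lambda1_le1 _ (mu0 i); have := dot_ge0 (p - q).
move: (dot _ _) (lambda1 _) (f i _) (f i p) (f i q) => dd la fm fp fq h1 h2.
have := ler_wpM2r h1 h2; rewrite mul1r.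
have := sqr_ge0 Ms; lra.
Qed.

Lemma bound_ge0 : 0 <= M.
Proof.
rewrite /M addr_ge0//; last by rewrite divr_ge0// sqr_ge0.
have Xp := Xprev (Ordinal N0).
by apply: le_trans (fMf (Ordinal N0) _ Xp); apply: f0; exact: XD.
Qed.

Lemma round_objective_ge0 v : (forall i, D (v i)) -> 0 <= G v.
Proof.
move=> Dv; rewrite /G addr_ge0//.
  apply: sumr_ge0 => i _; rewrite addr_ge0 ?f0//.
  by rewrite mulr_ge0 ?dot_ge0// divr_ge0// ltW// lambda1_gt0.
by rewrite mulr_ge0 ?divr_ge0//; apply: sumr_ge0 => e _; exact: dot_ge0.
Qed.

Lemma round_objective_const p : X p -> G (fun=> p) <= N%:R * M.
Proof.
move=> Xp; rewrite /G /round_objective [X in _ + _ * X]big1 => [|e _]; last first.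
  by rewrite subrr mulmx0 dot0l.
rewrite mulr0 addr0 -[X in X%:R * _]card_ord -sum1_card natr_sum mulr_suml.
apply: ler_sum => i _; rewrite mul1r /M lerD ?fMf//.
have := sq_diam _ _ Xp (Xprev i); have := lambda1_le1 _ (mu0 i).
have := lambda1_gt0 (mu i); have := dot_ge0 (p - xprev i).
move: (dot _ _) (lambda1 _) => dd la d0 l0 l1 h.
by have := ler_wpM2r d0 l1; lra.
Qed.

(** The joint form is evaluated with the edge variables at k times the
    midpoints.  The factor 1 controls the distance of the midpoints, and a
    larger one their norm in the edge Hessian. *)
Lemma sigma_curvature (k : R) v : 0 <= sg ->
  sg * k ^+ 2 * \sum_(e in E) dot (midpoints v e) (midpoints v e) <=
  W v + (k - 1) ^+ 2 * ed (midpoints v) (midpoints v).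
Proof.
move=> sg0.
have := sigma_le (d:=d) mu beta m E hE v (fun e => k *: midpoints v e); rewrite -/sg.
have -> : \sum_(e in E) dot (k *: midpoints v e) (k *: midpoints v e) =
    k ^+ 2 * \sum_(e in E) dot (midpoints v e) (midpoints v e).
  by rewrite mulr_sumr; apply: eq_bigr => e _; rewrite !dotE; ring.
have v0 : 0 <= \sum_i dot (v i) (v i) by apply: sumr_ge0 => i _; exact: dot_ge0.
have := mulr_ge0 sg0 v0; rewrite mulrDr.
suff : 2 * beta * m * \sum_(e in E)
    (dot (v e.1 - k *: midpoints v e) (v e.1 - k *: midpoints v e) +
     dot (v e.2 - k *: midpoints v e) (v e.2 - k *: midpoints v e)) <=
  beta * \sum_(e in E) dot (A e *m (v e.1 - v e.2)) (A e *m (v e.1 - v e.2)) +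
  (k - 1) ^+ 2 * ed (midpoints v) (midpoints v) by rewrite /W /curvature; lra.
rewrite /ed /edge_dot [(k - 1) ^+ 2 * _]mulrA !mulr_sumr -big_split /=; apply: ler_sum => e eE.
have /andP[h1 _] := hA e (v e.1 - k *: midpoints v e) eE.
have /andP[h2 _] := hA e (v e.2 - k *: midpoints v e) eE.
apply: (@le_trans _ _ (2 * beta *
   (dot (A e *m (v e.1 - k *: midpoints v e)) (A e *m (v e.1 - k *: midpoints v e)) +
    dot (A e *m (v e.2 - k *: midpoints v e)) (A e *m (v e.2 - k *: midpoints v e))))).
  by rewrite -[leLHS]mulrA ler_wpM2l ?mulr_ge0// mulrDr lerD.
rewrite !(mulmxDr, mulmxN) /midpoints -!scalemxAr mulmxDr.
move: (A e *m v e.1) (A e *m v e.2) => a c.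
by rewrite !dotE (dotC c a) le_eqVlt; apply/orP; left; apply/eqP; field.
Qed.

(** The multiple 4 beta l / (4 beta l - sigma) of the midpoints is the one for
    which [sigma_curvature] is sharpest. *)
Lemma curvature_midpoints v : 0 < sg -> sg < 4 * beta * l ->
  sg / (4 * beta * l - sg) * ed (midpoints v) (midpoints v) <= W v.
Proof.
move=> sg0 sc; have cs : 0 < 4 * beta * l - sg by rewrite subr_gt0.
have c0 : 0 < 4 * beta * l by exact: lt_trans sc.
have := sigma_curvature (4 * beta * l / (4 * beta * l - sg)) v (ltW sg0).
set S := \sum_(e in E) _.
have edS : ed (midpoints v) (midpoints v) <= 4 * beta * l * S.
  rewrite /ed /edge_dot -[leRHS]mulrA ler_wpM2l ?mulr_ge0// mulr_sumr.
  by apply: ler_sum => e eE; have /andP[] := hA e (midpoints v e) eE.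
have k2 : 0 <= sg * (4 * beta * l / (4 * beta * l - sg)) ^+ 2 / (4 * beta * l).
  by rewrite mulr_ge0 ?invr_ge0 ?(ltW c0)// mulr_ge0 ?sqr_ge0// ltW.
have := ler_wpM2l k2 edS.
move: c0 cs sc; move: (4 * beta * l) (ed _ _) => c q c0 cs sc.
have -> : sg * (c / (c - sg)) ^+ 2 / c * (c * S) = sg * (c / (c - sg)) ^+ 2 * S.
  by field; rewrite !gt_eqF.
move=> h1 h2; have {h1 h2} := le_trans h1 h2.
have -> : sg * (c / (c - sg)) ^+ 2 / c * q =
    sg / (c - sg) * q + (c / (c - sg) - 1) ^+ 2 * q.
  by field; rewrite !gt_eqF.
by rewrite lerD2r.
Qed.

(** The region D need not be closed, so that a minimizer may fail to exist. *)
Lemma near_minimizer e : 0 < e ->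
  exists2 u, (forall i, D (u i)) & forall v, (forall i, D (v i)) -> G u <= G v + e.
Proof.
move=> e0; pose S := [set G v | v in [set v | forall i, D (v i)]].
have Sinf : has_inf S.
  split; first by exists (G xprev), xprev => // i; exact: XD.
  by exists 0 => _ [v Dv <-]; exact: round_objective_ge0.
have [_ [u Du <-] uS] := inf_adherent e0 Sinf.
exists u => // v Dv; rewrite ltW// (lt_le_trans uS)// lerD2r.
by apply: ge_inf; [exact: Sinf.2|exists v].
Qed.

Lemma near_minimizer_curvature e p u : X p -> (forall i, D (u i)) ->
  (forall v, (forall i, D (v i)) -> G u <= G v + e) ->
  3 * W ((fun=> p) - u) <= 8 * (N%:R * M + 4 * e).
Proof.
move=> Xp Du umin; have Dp (i : 'I_N) : D p by exact: XD.
have h01 : 0 <= (1 / 4 : R) <= 1 by lra.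
have := umin _ (fun i => convex_setE D p (u i) _ cD (Dp i) (Du i) h01).
have := round_objective_convex mu beta f E A xprev D fconv (fun=> p) u _ Dp Du h01.
rewrite -/G -/W => h1 h2; have {h2} := le_trans h2 (lerD h1 (lexx e)).
have := round_objective_const p Xp; have := round_objective_ge0 u Du.
lra.
Qed.

(** The distance from the starting edge variables to a nearly optimal profile
    u is measured through a common point p of the action space: the starting
    variables are close to p by the diameter bound, and u is close to p
    because p is itself a feasible profile of bounded cost. *)
Lemma start_distance e u z : (0 < d)%N -> 0 < beta -> (0 < #|E|)%N ->
  (forall e, e \in E -> X (z e)) -> (forall i, D (u i)) ->
  (forall v, (forall i, D (v i)) -> G u <= G v + e) -> 0 < e ->
  sg * ed (z - midpoints u) (z - midpoints u) <=
  4 * beta * l * (20 * (N%:R * M) + 32 * e).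
Proof.
move=> d0 bp E0 Xz Du umin e0.
have [sg0 sc sE s3] := sigma_bounds mu beta m l wm E hE d0 mu0 bp m0 ml w_le E0.
have wm0 : 0 < wm.
  by apply: lt_le_trans (w_le (Ordinal N0)); rewrite addr_gt0// lambda1_gt0.
pose p := xprev (Ordinal N0); have Xp : X p by exact: Xprev.
pose P : 'I_N -> 'cV[R]_d := fun=> p.
pose S1 := \sum_(a in E) dot (z a - p) (z a - p).
pose S2 := \sum_(a in E) dot (midpoints (P - u) a) (midpoints (P - u) a).
have edS : ed (z - midpoints u) (z - midpoints u) <=
    4 * beta * l * (3 / 2 * S1 + 3 * S2).
  rewrite /ed /edge_dot -[leRHS]mulrA ler_wpM2l ?mulr_ge0//.
  rewrite mulrDr !mulr_sumr -big_split /=; apply: ler_sum => a aE.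
  have /andP[_] := hA a ((z - midpoints u) a) aE; move=> h; apply: le_trans h _.
  have -> : (z - midpoints u) a = (z a - p) + midpoints (P - u) a.
    by apply/matrixP => j k; rewrite !mxE; field.
  have l0 : 0 <= l by rewrite ltW// (lt_le_trans m0).
  rewrite -mulrDr ler_wpM2l//.
  have := dot_ge0 ((z a - p) - 2 *: midpoints (P - u) a).
  move: (z a - p) (midpoints _ a) => b c; rewrite !dotE (dotC c b); lra.
have S1b : sg * S1 <= 8 * (N%:R * M).
  rewrite -(ler_pM2l wm0).
  have h : wm * S1 <= #|E|%:R * (8 * M).
    rewrite mulr_sumr -sum1_card natr_sum mulr_suml; apply: ler_sum => a aE.
    by rewrite mul1r; exact: weighted_sq_diam (Xz a aE) Xp.
  have := ler_wpM2l (ltW sg0) h.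
  have M8 : 0 <= 8 * M by rewrite mulr_ge0// bound_ge0.
  have := ler_wpM2r M8 sE; lra.
have S2b : sg * S2 <= W (P - u).
  have := sigma_curvature 1 (P - u) (ltW sg0).
  by rewrite subrr expr0n mul0r addr0 expr1n mulr1.
have := near_minimizer_curvature e p u Xp Du umin; rewrite -/P => Wb.
have c0 : 0 <= 4 * beta * l by rewrite ltW// (lt_trans sg0).
apply: le_trans (ler_wpM2l (ltW sg0) edS) _.
rewrite mulrCA ler_wpM2l//; lra.
Qed.

Section Iterates.
Context (K : nat) (xs : nat -> 'I_N -> 'cV[R]_d)
  (zs : nat -> 'I_N * 'I_N -> 'cV[R]_d) (x : 'I_N -> 'cV[R]_d).
Hypotheses (hr : acord_round D mu beta f E A K xprev xs zs x) (K0 : (0 < K)%N)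
  (Xz : forall e, e \in E -> X (zs 0%N e)).

(** The edge variables of the algorithm, extended outside of the graph. *)
Let z k := if k is k'.+1 then midpoints (xs k'.+1) else zs 0%N.

Let argmin_z k i : (k < K)%N ->
  is_argmin D (local_objective mu beta f E A xprev (z k) i) (xs k.+1 i).
Proof.
move=> kK; have [/(_ k.+1 i) h hz _] := hr; have := h kK.
rewrite (_ : local_objective _ _ _ _ _ _ (zs k.+1.-1) i =
  local_objective mu beta f E A xprev (z k) i)//.
apply/funext => y; congr (_ + _ * _); apply: eq_bigr => e /andP[eE _].
by case: k kK {h} => // k kK; rewrite hz ?(ltnW kK).
Qed.

Let xE : x = xs K.
Proof. by case: hr => _ _ h; apply/funext. Qed.

Let xsD k : (0 < k <= K)%N -> forall i, D (xs k i).
Proof. by case: k => // k kK i; case: (argmin_z k i kK). Qed.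

Lemma three_point_iterate k v : (k < K)%N -> (forall i, D (v i)) ->
  G (xs k.+1) + 1 / 2 * W (v - xs k.+1) +
    ed (z k - z k.+1) (midpoints v - z k.+1) <= G v.
Proof.
move=> kK Dv; apply: (three_point mu beta f E A xprev D hE cD fconv) => // i.
exact: argmin_z.
Qed.

Lemma round_gap_uncoupled v : (forall a, ed a a = 0) -> (forall i, D (v i)) ->
  G x <= G v.
Proof.
move=> ed0 Dv; case: K K0 xE three_point_iterate => // k _ -> /(_ k v (ltnSn k) Dv).
rewrite -/z.
have edz a b : ed a b = 0.
  have := ed0 (a + b); rewrite /ed !edge_dotE -!/(ed _ _) !ed0 /ed (edge_dotC _ _ _ b a).
  lra.
rewrite edz addr0; apply: le_trans; rewrite lerDl mulr_ge0//.
exact: curvature_ge0.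
Qed.

(** The target of [alternating_rate] is a near-minimizer: the gap to any other
    profile exceeds the gap to it by an arbitrarily small slack at most. *)
Lemma round_gap_bound v eta : (0 < d)%N -> 0 < beta -> (0 < #|E|)%N ->
  (forall i, D (v i)) ->
  eta = sg / (4 * beta * l - sg) ->
  sg * ((G x - G v) * ((1 + eta) ^+ K * ((1 + eta) ^+ K - 1) / eta)) <=
  40 * (beta * l * (N%:R * M)).
Proof.
move=> d0 bp E0 Dv etaE.
have [sg0 sc sE s3] := sigma_bounds mu beta m l wm E hE d0 mu0 bp m0 ml w_le E0.
have eta0 : 0 < eta by rewrite etaE divr_gt0// subr_gt0.
set C := (1 + eta) ^+ K * _ / eta.
have C0 : 0 <= C.
  have h1 : 1 <= (1 + eta) ^+ K by rewrite exprn_ege1// lerDl ltW.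
  by rewrite divr_ge0 ?(ltW eta0)// mulr_ge0 ?subr_ge0// (le_trans ler01).
have c0 : 0 < beta * l by rewrite mulr_gt0// (lt_le_trans m0).
apply: (@le_of_linear_slack _ _ _ (sg * C + 64 * (beta * l))).
  by apply: addr_ge0; apply: mulr_ge0 => //; exact: ltW.
move=> e e0; have [u Du umin] := near_minimizer e e0.
have gu : (G x - G v) * C <= (G x - G u) * C + e * C.
  by rewrite -mulrDl ler_wpM2r//; have := umin v Dv; lra.
have hmid k (v1 v2 : 'I_N -> 'cV[R]_d) : k = midpoints v2 ->
    midpoints v1 - k = midpoints (v1 - v2).
  move=> ->; apply/funext => a; apply/matrixP => i j.
  by rewrite !mxE; field.
have rate : (G x - G u) * C <= 1 / 2 * ed (z 0%N - midpoints u) (z 0%N - midpoints u).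
  rewrite xE; apply: (@alternating_rate _ _ _ _ beta E A eta K (fun k => G (xs k)) (G u) z) => //.
    move=> k kK; have := three_point_iterate k u kK Du.
    have := curvature_midpoints (u - xs k.+1) sg0 sc; rewrite -etaE.
    rewrite -(hmid (z k.+1))// -/ed; lra.
  case=> // k kK; have Dk : forall i, D (xs k.+1 i) by exact: (xsD k.+1 (ltnW kK)).
  have := three_point_iterate k.+1 (xs k.+1) kK Dk.
  have := curvature_midpoints (xs k.+1 - xs k.+2) sg0 sc; rewrite -etaE.
  rewrite -(hmid (z k.+2))// -/(z k.+1) -/ed; lra.
have := start_distance e u (zs 0%N) d0 bp E0 Xz Du umin e0.
have := ler_wpM2l (ltW sg0) gu; have := ler_wpM2l (ltW sg0) rate.
rewrite -/(z 0%N); lra.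
Qed.

End Iterates.
End RoundGap.

(** * The number of inner iterations *)

Section IterationCount.
Context {R : realType} {N : nat} (d : nat) (mu : 'I_N -> R) (beta m l Mf Ms : R)
  (E : {set 'I_N * 'I_N}).

Let K T := K_iter d mu beta m l Mf Ms T E.
Let F T := K_formula d mu beta m l Mf Ms T E.
Let sg := sigma d mu beta m E.
Let B (T : nat) : R :=
  T%:R ^+ 4 * 128 * beta * l * N%:R * (Mf + Ms ^+ 2 / 2)
    * fmax (fun i => mu i + lambda1 (mu i))
  / (sg * fmin (fun i => lambda1 (mu i))) ^+ 2.

Lemma K_iterE T : (K T)%:R = Num.max 1 (Num.ceil (F T))%:~R :> R.
Proof.
rewrite /K /K_iter -/(F T) natr_absz ger0_norm ?le_max ?ler01//.
by rewrite !maxEle -(ler_int R 1); case: ifP.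
Qed.

Lemma K_iter_gt0 T : (0 < K T)%N.
Proof. by rewrite -(ltr0n R) K_iterE lt_max ltr01. Qed.

Lemma K_iter_ge T : F T <= (K T)%:R.
Proof. by rewrite K_iterE le_max ceil_ge orbT. Qed.

Lemma K_iter_le T : (K T)%:R <= `|F T| + 1.
Proof.
rewrite K_iterE ge_max lerDr normr_ge0/=.
have /andP[h _] := ceil_itv (F T).
rewrite -lerBlDr -(intrD _ _ (-1)); apply: le_trans (ltW h) (ler_norm _).
Qed.

Lemma expr_K_iter_ge T : 0 < sg -> sg < 4 * beta * l ->
  B T <= (4 * beta * l / (4 * beta * l - sg)) ^+ K T.
Proof.
move=> sg0 sc; have := K_iter_ge T; rewrite /F /K_formula -/sg -/(B T).
have cs : 0 < 4 * beta * l - sg by rewrite subr_gt0.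
have c0 := lt_trans sg0 sc.
set rho := _ / (_ - sg).
have r1 : 1 < rho by rewrite /rho ltr_pdivlMr// mul1r ltrBlDr ltrDl.
have r0 : 0 < rho by exact: lt_trans r1.
have [B0|B0 _] := ltP 0 (B T); last first.
  by rewrite (le_trans B0)// exprn_ge0// ltW.
rewrite ler_pdivrMr ?ln_gt0// => h.
by rewrite -ler_ln ?posrE ?exprn_gt0// lnXn// -mulr_natl.
Qed.

Lemma K_iter_bigO :
  (fun T : nat => (K T)%:R : R) =O_\oo (fun T : nat => ln T%:R : R).
Proof.
pose c : R := 128 * beta * l * N%:R * (Mf + Ms ^+ 2 / 2)
    * fmax (fun i => mu i + lambda1 (mu i))
  / (sg * fmin (fun i => lambda1 (mu i))) ^+ 2.
pose i := `|(ln (4 * beta * l / (4 * beta * l - sg)))^-1|.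
have ln2 : 0 < ln 2 :> R by rewrite ln_gt0// ltr1n.
apply/eqOP; near=> k; near=> T.
have T2 : (2 <= T)%N by near: T; exact: nbhs_infty_ge.
have T0 : 0 < T%:R :> R by rewrite ltr0n (leq_trans _ T2).
have lnT : ln 2 <= ln T%:R :> R by rewrite ler_ln ?posrE// ler_nat.
have lnT0 := lt_le_trans ln2 lnT.
rewrite ger0_norm ?ler0n// (ger0_norm (ltW lnT0)).
apply: le_trans (K_iter_le T) _.
have Fb : `|F T| <= (4 * ln T%:R + `|ln c|) * i.
  rewrite /F /K_formula -/sg -/(B T) normrM ler_wpM2r ?normr_ge0//.
  have -> : B T = T%:R ^+ 4 * c by rewrite /B /c !mulrA.
  have [c0|c0] := ltP 0 c.
    rewrite lnM ?posrE ?exprn_gt0// lnXn//.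
    apply: le_trans (ler_normD _ _) _.
    by rewrite lerD2r -(mulr_natl (ln T%:R) 4) ger0_norm ?mulr_ge0 ?(ltW lnT0).
  rewrite (_ : ln (T%:R ^+ 4 * c) = 0); last by rewrite ln0// mulr_ge0_le0// exprn_ge0// ltW.
  by rewrite normr0 addr_ge0 ?normr_ge0// mulr_ge0// ltW.
have i0 : 0 <= i by exact: normr_ge0.
have kb : 4 * i + (`|ln c| * i + 1) / ln 2 <= k.
  by near: k; apply: nbhs_pinfty_ge; rewrite num_real.
apply: le_trans (ler_wpM2r (ltW lnT0) kb).
have h : `|ln c| * i + 1 <= (`|ln c| * i + 1) / ln 2 * ln T%:R.
  rewrite -mulrA ler_peMr ?addr_ge0 ?mulr_ge0//.
  by rewrite mulrC ler_pdivlMr// mul1r.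
by move: Fb h; lra.
Unshelve. all: by end_near. Qed.

End IterationCount.

(** * The gap after one round *)

(** Arithmetic behind the choice of the iteration count: the factor eta in the
    gap bound is compensated by Q - 1 >= eta when eta is small, and by
    sg <= 2 wm / (3 + eta) when eta is large. *)
Lemma gap_arith {R : realType} (a eta Q B sg wm lam T4 S : R) :
  0 < eta -> 0 < sg -> 0 < wm -> 0 < T4 -> 1 + eta <= Q -> B <= Q ->
  (3 + eta) * sg <= 2 * wm -> B * (sg * lam) ^+ 2 = 128 * T4 * S * wm ->
  sg * (a * (Q * (Q - 1) / eta)) <= 40 * S ->
  a * T4 * (Q + 2) <= 5 / 8 * lam ^+ 2.
Proof.
move=> eta0 sg0 wm0 T40 Qe QB sw BS h.
have Q1 : 1 < Q by apply: lt_le_trans Qe; rewrite ltrDl.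
have Q0 : 0 < Q by exact: lt_trans Q1.
have [a0|a0] := leP a 0.
  apply: (@le_trans _ _ 0); last by apply: mulr_ge0 (sqr_ge0 _); lra.
  by rewrite !mulr_le0_ge0// ?ltW// addr_gt0.
have h1 : a * T4 * (Q - 1) * wm * 128 * (Q * sg) <= 40 * eta * sg * lam ^+ 2 * (Q * sg).
  have -> : a * T4 * (Q - 1) * wm * 128 * (Q * sg) =
      (128 * T4 * wm * eta) * (sg * (a * (Q * (Q - 1) / eta))).
    by field; rewrite gt_eqF.
  have p0 : 0 <= 128 * T4 * wm * eta by rewrite !mulr_ge0// ltW.
  apply: le_trans (ler_wpM2l p0 h) _.
  have -> : 128 * T4 * wm * eta * (40 * S) = 40 * eta * (B * (sg * lam) ^+ 2).
    by rewrite BS; ring.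
  have -> : 40 * eta * sg * lam ^+ 2 * (Q * sg) = 40 * eta * (Q * (sg * lam) ^+ 2) by ring.
  by rewrite ler_wpM2l ?mulr_ge0 ?(ltW eta0)// ler_wpM2r ?sqr_ge0.
rewrite ler_pM2r ?mulr_gt0// in h1.
have aTQ : 0 <= a * T4 * (Q - 1) by rewrite !mulr_ge0 ?subr_ge0// ltW.
have h2 : a * T4 * (Q - 1) * (3 + eta) * 64 * sg <= 40 * eta * lam ^+ 2 * sg.
  have := ler_wpM2l aTQ sw; lra.
rewrite ler_pM2r// in h2.
have h3 : eta * (Q + 2) <= (Q - 1) * (3 + eta) by lra.
have aT : 0 <= a * T4 by rewrite mulr_ge0// ltW.
by rewrite -(ler_pM2l eta0); have := ler_wpM2l aT h3; lra.
Qed.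

Section RoundConclusion.
Context {R : realType} {N d r : nat} (mu : 'I_N -> R) (beta m l : R)
  (f : 'I_N -> 'cV[R]_d -> R) (E : {set 'I_N * 'I_N})
  (A : 'I_N * 'I_N -> 'M[R]_(r, d)) (xprev : 'I_N -> 'cV[R]_d)
  (D X : set 'cV[R]_d) (Mf Ms : R).
Hypotheses (N0 : (0 < N)%N) (hE : edge_set E) (b0 : 0 <= beta)
  (m0 : 0 < m) (ml : m <= l) (mu0 : forall i, 0 < mu i)
  (hA : forall e v, e \in E ->
     m * dot v v <= dot (A e *m v) (A e *m v) <= l * dot v v)
  (cD : convex_set D) (XD : X `<=` D)
  (hMs : forall p q, X p -> X q -> norm2 (p - q) <= Ms)
  (fconv : forall i, strongly_convex D (mu i) (f i))
  (f0 : forall i p, D p -> 0 <= f i p) (fMf : forall i p, X p -> f i p <= Mf)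
  (Xprev : forall i, X (xprev i)).

Let lam := lambda1 (fmin mu).
Let M := Mf + Ms ^+ 2 / 2.
Let G := round_objective mu beta f E A xprev.

(** The sharper of the two gap bounds can fail only if the argument of the
    logarithm in the iteration count is below 10; since sigma is below both
    4 beta l and 2 / 3 of the largest agent weight, the feasible costs are then
    themselves of order lam ^+ 2 / T ^+ 4. *)
Lemma round_gap (T : nat) xs zs x : (0 < T)%N ->
  acord_round D mu beta f E A (K_iter d mu beta m l Mf Ms T E) xprev xs zs x ->
  (forall e, e \in E -> X (zs 0%N e)) ->
  (forall v, (forall i, D (v i)) -> T%:R ^+ 4 * (G x - G v) <= 5 / 24 * lam ^+ 2) /\
  (T%:R ^+ 4 * (N%:R * M) <= 1 / 4 * lam ^+ 2 \/
   forall v, (forall i, D (v i)) -> T%:R ^+ 4 * (G x - G v) <= 7 / 128 * lam ^+ 2).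
Proof.
move=> T0 hr Xz; set K := K_iter d mu beta m l Mf Ms T E in hr.
have K0 : (0 < K)%N by exact: K_iter_gt0.
have T4 : 0 < T%:R ^+ 4 :> R by rewrite exprn_gt0// ltr0n.
have lam2 : 0 <= lam ^+ 2 by exact: sqr_ge0.
have [ed0|[d0 bp E0]] : (forall a, edge_dot beta E A a a = 0) \/
    [/\ (0 < d)%N, 0 < beta & (0 < #|E|)%N].
  have [d0|d0] := posnP d.
    left=> a; rewrite /edge_dot big1 ?mulr0// => e _.
    have -> : a e = 0 by apply/matrixP => i; have := ltn_ord i; rewrite {2}d0.
    by rewrite mulmx0 dot0l.
  move: b0; rewrite le_eqVlt => /predU1P[<-|bp].
    by left=> a; rewrite /edge_dot mulr0 mul0r.
  have [E0|E0] := posnP #|E|; last by right.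
  by left=> a; rewrite /edge_dot (cards0_eq E0) big_set0 mulr0.
  have h v : (forall i, D (v i)) -> T%:R ^+ 4 * (G x - G v) <= 0.
    move=> Dv; rewrite pmulr_rle0// subr_le0.
    by apply: (@round_gap_uncoupled _ _ _ _ mu beta f E A xprev D) hr _ _ _ _.
  by split; [|right] => v /h vh; apply: le_trans vh _; rewrite mulr_ge0//; lra.
pose sg := sigma d mu beta m E.
pose wm := fmax (fun i => mu i + lambda1 (mu i)).
have w_le i : mu i + lambda1 (mu i) <= wm.
  by have [j jE jmax] := fmaxP (fun i => mu i + lambda1 (mu i)) i; rewrite /wm jE.
have wm0 : 0 < wm.
  by apply: lt_le_trans (w_le (Ordinal N0)); rewrite addr_gt0// lambda1_gt0.
have [sg0 sc _ s3] := sigma_bounds mu beta m l wm E hE d0 mu0 bp m0 ml w_le E0.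
rewrite -/sg in sg0 sc s3.
pose eta := sg / (4 * beta * l - sg).
have cs : 0 < 4 * beta * l - sg by rewrite subr_gt0.
have eta0 : 0 < eta by rewrite divr_gt0.
have etaE : 4 * beta * l / (4 * beta * l - sg) = 1 + eta.
  by rewrite /eta; field; rewrite gt_eqF.
pose Q := (1 + eta) ^+ K.
have Qe : 1 + eta <= Q.
  by rewrite -[leLHS]expr1; apply: ler_weXn2l K0; rewrite lerDl ltW.
have lam0 : 0 < lam by exact: lambda1_gt0.
pose S := beta * l * (N%:R * M).
pose B := 128 * T%:R ^+ 4 * S * wm / (sg * lam) ^+ 2.
have BE : B * (sg * lam) ^+ 2 = 128 * T%:R ^+ 4 * S * wm.
  by rewrite /B mulfVK// gt_eqF// exprn_gt0// mulr_gt0.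
have QB : B <= Q.
  rewrite /Q -etaE; apply: le_trans (expr_K_iter_ge _ _ _ _ _ Mf Ms _ T sg0 sc).
  rewrite fmin_lambda1// -/lam -/sg -/wm -/M /B /S le_eqVlt; apply/orP; left.
  by apply/eqP; congr (_ / _); ring.
have gap v : (forall i, D (v i)) ->
    (G x - G v) * T%:R ^+ 4 * (Q + 2) <= 5 / 8 * lam ^+ 2.
  move=> Dv; apply: (gap_arith _ eta _ B sg wm _ _ S) => //.
  exact: (round_gap_bound mu beta m l f E A xprev D X Mf Ms N0 hE b0 m0 ml mu0
    hA cD XD hMs fconv f0 fMf Xprev K xs zs x hr Xz v eta).
have Q1 : 1 <= Q by apply: le_trans Qe; rewrite lerDl ltW.
split=> [v /gap vh|].
  have [g0|g0] := leP (G x - G v) 0.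
    apply: (@le_trans _ _ 0); first by rewrite pmulr_rle0.
    by rewrite mulr_ge0//; lra.
  have p0 : 0 <= (G x - G v) * T%:R ^+ 4 by rewrite mulr_ge0 ?ltW.
  have := ler_wpM2l p0 Q1; lra.
have [B10|B10] := leP 10 B.
  right=> v /gap vh.
  have [g0|g0] := leP (G x - G v) 0.
    apply: (@le_trans _ _ 0); first by rewrite pmulr_rle0.
    by rewrite mulr_ge0//; lra.
  have p0 : 0 <= (G x - G v) * T%:R ^+ 4 by rewrite mulr_ge0 ?ltW.
  have := ler_wpM2l p0 (le_trans B10 QB); lra.
left.
have bl : 0 < beta * l by rewrite mulr_gt0// (lt_le_trans m0).
have p0 : 0 < 128 * (beta * l) * wm by apply: mulr_gt0 => //; apply: mulr_gt0.
rewrite -(ler_pM2l p0).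
have -> : 128 * (beta * l) * wm * (T%:R ^+ 4 * (N%:R * M)) = B * (sg * lam) ^+ 2.
  by rewrite BE /S; ring.
apply: (@le_trans _ _ (10 * (sg * lam) ^+ 2)).
  by rewrite ler_wpM2r ?sqr_ge0 ?ltW.
have s2 : 3 * sg <= 2 * wm.
  by apply: le_trans s3; rewrite ler_pM2r// lerDl ltW.
have : sg * sg <= 4 * beta * l * (2 / 3 * wm).
  by apply: ler_pM; rewrite ?(ltW sg0) ?(ltW sc)//; lra.
have := mulr_ge0 (ltW (mulr_gt0 bl wm0)) lam2.
by move=> h /(ler_wpM2r lam2); rewrite (exprMn _ sg lam); lra.
Qed.

Lemma round_objective_le (T : nat) xs zs x : (0 < T)%N ->
  acord_round D mu beta f E A (K_iter d mu beta m l Mf Ms T E) xprev xs zs x ->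
  (forall e, e \in E -> X (zs 0%N e)) ->
  T%:R ^+ 4 * G x <= T%:R ^+ 4 * (N%:R * M) + 5 / 24 * lam ^+ 2.
Proof.
move=> T0 hr Xz; have [h _] := round_gap _ _ _ _ T0 hr Xz.
have Xp := Xprev (Ordinal N0).
have := h (fun=> xprev (Ordinal N0)) (fun i => XD _ Xp).
have T4 : 0 <= T%:R ^+ 4 :> R by rewrite exprn_ge0.
have := round_objective_const mu beta f E A xprev X Mf Ms mu0 hMs fMf Xprev _ Xp.
by move=> /(ler_wpM2l T4); rewrite -/G -/M; lra.
Qed.

End RoundConclusion.

(** * From one round to the whole horizon *)

Section Comparison.
Context {R : realType} {N d r : nat} (mu : 'I_N -> R) (beta : R)
  (f : 'I_N -> 'cV[R]_d -> R) (E : {set 'I_N * 'I_N})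
  (A : 'I_N * 'I_N -> 'M[R]_(r, d)) (D : set 'cV[R]_d).
Hypotheses (N0 : (0 < N)%N) (b0 : 0 <= beta) (mu0 : forall i, 0 < mu i)
  (cD : convex_set D) (fconv : forall i, strongly_convex D (mu i) (f i))
  (f0 : forall i p, D p -> 0 <= f i p).
Implicit Types x y u v : 'I_N -> 'cV[R]_d.

Let lam := lambda1 (fmin mu).

Lemma lam_le i : lam <= lambda1 (mu i).
Proof.
have [j jE jmin] := fminP mu i.
by rewrite /lam jE; apply: lambda1_homo.
Qed.

Lemma round_costE xp v : round_cost beta f E A xp v =
  \sum_i (f i (v i) + 1 / 2 * dot (v i - xp i) (v i - xp i)) +
  beta / 2 * \sum_(e in E) dot (A e *m (v e.1 - v e.2)) (A e *m (v e.1 - v e.2)).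
Proof.
congr (_ + _ * _); first by apply: eq_bigr => i _; rewrite norm2_sq.
by apply: eq_bigr => e _; rewrite norm2_sq mulmxBr.
Qed.

Lemma round_cost_ge v xp : \sum_i f i (v i) <= round_cost beta f E A xp v.
Proof.
rewrite round_costE big_split /= -addrA lerDl addr_ge0//.
  by apply: sumr_ge0 => i _; rewrite mulr_ge0 ?dot_ge0.
by rewrite mulr_ge0 ?divr_ge0//; apply: sumr_ge0 => e _; exact: dot_ge0.
Qed.

(** The weight 1 / lam that turns the round objective into the cost
    leaves room on the hitting costs, whose coefficient is already 1. *)
Lemma round_cost_le_objective tau v xp : 0 <= tau <= 1 -> (forall i, D (v i)) ->
  (1 - tau) * (1 + tau) * lam * round_cost beta f E A xp v <=
  (1 + tau * lam) *
    (round_objective mu beta f E A xp v - tau * \sum_i f i (v i)).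
Proof.
move=> /andP[t0 t1] Dv; rewrite round_costE /round_objective !big_split /=.
have lam0 : 0 < lam by exact: lambda1_gt0.
have lam1 : lam <= 1 by apply: le_trans (lam_le (Ordinal N0)) (lambda1_le1 _ _).
have S0 : 0 <= \sum_i f i (v i) by apply: sumr_ge0 => i _; exact: f0.
have C0 : 0 <= beta / 2 * \sum_(e in E) dot (A e *m (v e.1 - v e.2)) (A e *m (v e.1 - v e.2)).
  by rewrite mulr_ge0 ?divr_ge0//; apply: sumr_ge0 => e _; exact: dot_ge0.
have M0 : 0 <= \sum_i 1 / 2 * dot (v i - xp i) (v i - xp i).
  by apply: sumr_ge0 => i _; rewrite mulr_ge0 ?dot_ge0.
have Mle : lam * \sum_i 1 / 2 * dot (v i - xp i) (v i - xp i) <=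
    \sum_i lambda1 (mu i) / 2 * dot (v i - xp i) (v i - xp i).
  rewrite mulr_sumr; apply: ler_sum => i _.
  have := ler_wpM2r (dot_ge0 (v i - xp i)) (lam_le i); lra.
move: S0 C0 M0 Mle; move: (\sum_i f i (v i)) (beta / 2 * _).
move: (\sum_i 1 / 2 * _) (\sum_i lambda1 _ / 2 * _) => Mv Lv S C S0 C0 M0 Mle.
have tl0 : 0 <= tau * lam by rewrite mulr_ge0// ltW.
have tt : 0 <= 1 - tau by rewrite subr_ge0.
have hS : 0 <= (1 - tau) * (1 - lam) * S by rewrite !mulr_ge0// subr_ge0.
have hC : 0 <= (1 - lam) * C by rewrite mulr_ge0// subr_ge0.
have hL : 0 <= Lv - lam * Mv by rewrite subr_ge0.
have hT : 0 <= tau ^+ 2 * lam * C by rewrite !mulr_ge0 ?sqr_ge0// ltW.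
have hTM : 0 <= tau ^+ 2 * lam * Mv by rewrite !mulr_ge0 ?sqr_ge0// ltW.
have hlC : 0 <= tau * lam * C by rewrite mulr_ge0.
have hlM : 0 <= tau * lam * (Lv - lam * Mv) by rewrite mulr_ge0.
have hlM2 : 0 <= tau * lam * (lam * Mv) by rewrite !mulr_ge0// ltW.
lra.
Qed.

Definition potential x y : R :=
  1 / 2 * \sum_i (mu i + lambda1 (mu i)) * dot (x i - y i) (x i - y i).

Lemma potential_ge0 x y : 0 <= potential x y.
Proof.
rewrite mulr_ge0//; apply: sumr_ge0 => i _.
by rewrite mulr_ge0 ?dot_ge0// addr_ge0// ltW// lambda1_gt0.
Qed.

Lemma potential_refl x : potential x x = 0.
Proof. by rewrite /potential big1 ?mulr0// => i _; rewrite subrr dot0l mulr0. Qed.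

Lemma round_objective_comparator xp yp y :
  round_objective mu beta f E A xp y <=
  round_cost beta f E A yp y + potential xp yp.
Proof.
rewrite round_costE /round_objective /potential addrAC lerD2r.
rewrite mulr_sumr -big_split /=; apply: ler_sum => i _.
rewrite -addrA lerD2l.
have -> : y i - xp i = (y i - yp i) - (xp i - yp i) by rewrite opprB addrA subrK.
move: (y i - yp i) (xp i - yp i) => a b; have m0 := mu0 i.
have sq := dot_ge0 (lambda1 (mu i) *: a + mu i *: b).
have le := lambda1_sq _ m0; move: sq; rewrite !dotE (dotC b a).
move: le m0; move: (mu i) (lambda1 (mu i)) (dot a a) (dot a b) (dot b b).
move=> mui la aa ab bb le m0 sq.
have : 0 <= mui * ((1 - la) * aa + 2 * la * ab + mui * bb).
  have -> : mui * ((1 - la) * aa + 2 * la * ab + mui * bb) =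
      (mui * (1 - la)) * aa + 2 * la * mui * ab + mui ^+ 2 * bb by ring.
  by rewrite -le; lra.
by rewrite pmulr_rge0//; lra.
Qed.

Lemma potential_le_hitting x y : (forall i, D (x i)) -> (forall i, D (y i)) ->
  lam * potential x y <= 2 * (\sum_i f i (x i) + \sum_i f i (y i)).
Proof.
move=> Dx Dy; rewrite /potential -big_split !mulr_sumr; apply: ler_sum => i _ /=.
have h01 : 0 <= (1 / 2 : R) <= 1 by lra.
have := fconv i _ _ _ (Dx i) (Dy i) h01; rewrite norm2_sq.
have := f0 i _ (convex_setE D _ _ _ cD (Dx i) (Dy i) h01).
have w0 : 0 <= mu i + lambda1 (mu i) by rewrite addr_ge0// ltW// lambda1_gt0.
have := ler_wpM2l w0 (lam_le i); rewrite lambda1_weight//.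
move=> /(ler_wpM2r (dot_ge0 (x i - y i))); lra.
Qed.

(** Testing near-optimality of x at a point of the segment from x to y
    close to x retains almost all of the potential. *)
Lemma near_optimal_potential xp x y theta eps : 0 < theta <= 1 ->
  (forall i, D (x i)) -> (forall i, D (y i)) ->
  (forall v, (forall i, D (v i)) -> round_objective mu beta f E A xp x -
     round_objective mu beta f E A xp v <= eps * theta) ->
  round_objective mu beta f E A xp x + (1 - theta) * potential x y <=
  round_objective mu beta f E A xp y + eps.
Proof.
move=> /andP[t0 t1] Dx Dy xopt; have t01 : 0 <= theta <= 1 by rewrite ltW.
have h3 : round_objective mu beta f E A xp x - round_objective mu beta f E A xp
    (theta *: y + (1 - theta) *: x) <= eps * theta.
  by apply: xopt => i; exact: convex_setE.
have := round_objective_convex mu beta f E A xp D fconv y x theta Dy Dx t01.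
have tt : 0 <= theta * (1 - theta) by rewrite mulr_ge0 ?subr_ge0// ltW.
have : 2 * potential x y <= curvature mu beta E A (y - x).
  apply: le_trans (curvature_ge_diag mu beta E A b0 (y - x)).
  rewrite /potential mulrA (_ : 2 * (1 / 2) = 1 :> R) ?mul1r; last by field.
  rewrite le_eqVlt; apply/orP; left; apply/eqP; apply: eq_bigr => i _.
  rewrite -[(y - x) i]/(y i - x i) -[x i - y i]opprB !dotE; ring.
move=> /(ler_wpM2l tt) h1 h2; rewrite -(ler_pM2l t0); lra.
Qed.

End Comparison.

(* D is the region over which the minimizations defining ACORD and OPT range:
   all of R^d for the unconstrained problem, or the action space X itself. *)
Theorem theorem3p1 (R : realType) (N d : nat) (mu : 'I_N -> R)
    (beta m l Mf Ms : R)
    (hN : (0 < N)%N) (hmu : forall i, 0 < mu i) (hbeta : 0 <= beta)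
    (hm : 0 < m) (hml : m <= l) :
  (forall E : {set 'I_N * 'I_N}, edge_set E ->
     (fun T : nat => (K_iter d mu beta m l Mf Ms T E)%:R : R)
       =O_\oo (fun T : nat => ln T%:R : R))
  /\
  (forall (T : nat) (r : nat -> nat) (f : nat -> 'I_N -> 'cV[R]_d -> R)
      (E : nat -> {set 'I_N * 'I_N})
      (A : forall t, 'I_N * 'I_N -> 'M[R]_(r t, d))
      (D X : set 'cV[R]_d)
      (x y : nat -> 'I_N -> 'cV[R]_d)
      (xs : nat -> nat -> 'I_N -> 'cV[R]_d)
      (zs : nat -> nat -> 'I_N * 'I_N -> 'cV[R]_d),
    (0 < T)%N ->
    (* graphs and edge matrices *)
    (forall t, (1 <= t <= T)%N -> edge_set (E t)) ->
    (forall t e, (1 <= t <= T)%N -> e \in E t ->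
       [/\ (d <= r t)%N, \rank (A t e) = d
         & forall s, singular_value (A t e) s ->
             Num.sqrt m <= s <= Num.sqrt l]) ->
    (* action space of diameter at most Ms *)
    convex_set D -> X `<=` D ->
    (forall p q, X p -> X q -> norm2 (p - q) <= Ms) ->
    (* hitting costs: strongly convex, nonnegative, bounded by Mf *)
    (forall t i, (1 <= t <= T)%N -> strongly_convex D (mu i) (f t i)) ->
    (forall t i p, (1 <= t <= T)%N -> D p -> 0 <= f t i p) ->
    (forall t i p, (1 <= t <= T)%N -> X p -> f t i p <= Mf) ->
    (* ACORD, with arbitrary starting points in the action space *)
    (forall t i, (t <= T)%N -> X (x t i)) ->
    (forall t e, (1 <= t <= T)%N -> e \in E t -> X (zs t 0%N e)) ->
    (forall t, (1 <= t <= T)%N ->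
       acord_round D mu beta (f t) (E t) (A t)
         (K_iter d mu beta m l Mf Ms T (E t)) (x t.-1) (xs t) (zs t) (x t)) ->
    is_OPT D beta f E A T (x 0%N) y ->
    Cost beta f E A T x <=
      CR_ACORD mu T * Cost beta f E A T y
      + (1 + beta * (m ^+ 2 / l)) / (4 * T%:R)).
Proof.
split=> [E _|T r f E A D X x y xs zs T0 hE hA cD XD hMs fconv f0 fMf xX zX hx yopt].
  exact: K_iter_bigO.
pose lam := lambda1 (fmin mu).
have lam0 : 0 < lam by exact: lambda1_gt0.
have lam1 : lam <= 1 by apply: le_trans (lam_le mu hmu (Ordinal hN)) (lambda1_le1 _ _).
have [[/= y0 yD] _] := yopt.
pose G t := round_objective mu beta (f t) (E t) (A t) (x t.-1).
pose F t (v : 'I_N -> 'cV[R]_d) := \sum_i f t i (v i).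
pose cost t (v : nat -> 'I_N -> 'cV[R]_d) :=
  round_cost beta (f t) (E t) (A t) (v t.-1) (v t).
pose phi t := potential mu (x t) (y t).
pose T4 : R := T%:R ^+ 4.
pose NM : R := N%:R * (Mf + Ms ^+ 2 / 2).
have Tp : 0 < T%:R :> R by rewrite ltr0n.
have T40 : 0 < T4 by rewrite exprn_gt0.
have l0 : 0 < l by exact: lt_le_trans hml.
have xD t i : (t <= T)%N -> D (x t i) by move=> tT; apply/XD/xX.
have prevT t : (1 <= t <= T)%N -> (t.-1 <= T)%N.
  by move=> /andP[_]; apply: leq_trans; exact: leq_pred.
have hA' t : (1 <= t <= T)%N -> forall e v, e \in E t ->
    m * dot v v <= dot (A t e *m v) (A t e *m v) <= l * dot v v.
  move=> tT e v eE; have [_ _ sv] := hA t e tT eE.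
  exact: singular_value_bounds.
have F0 t v : (1 <= t <= T)%N -> (forall i, D (v i)) -> 0 <= F t v.
  by move=> tT Dv; apply: sumr_ge0 => i _; exact: f0.
have costy t : (1 <= t <= T)%N -> F t (y t) <= cost t y.
  by move=> tT; exact: round_cost_ge.
have CostE v : Cost beta f E A T v = \sum_(1 <= t < T.+1) cost t v by [].
have Cy0 : 0 <= Cost beta f E A T y.
  rewrite CostE big_nat; apply: sumr_ge0 => t tT.
  by apply: le_trans (costy t tT); apply: F0 => // i; exact: yD.
have gap t (tT : (1 <= t <= T)%N) :
    (forall v, (forall i, D (v i)) -> T4 * (G t (x t) - G t v) <= 5 / 24 * lam ^+ 2) /\
    (T4 * NM <= 1 / 4 * lam ^+ 2 \/
     forall v, (forall i, D (v i)) -> T4 * (G t (x t) - G t v) <= 7 / 128 * lam ^+ 2).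
  apply: (round_gap mu beta m l (f t) (E t) (A t) (x t.-1) D X Mf Ms hN (hE t tT)
    hbeta hm hml hmu (hA' t tT) cD XD hMs (fun i => fconv t i tT)
    (fun i p => f0 t i p tT) (fun i p => fMf t i p tT)
    (fun i => xX _ i (prevT t tT)) T (xs t) (zs t) (x t) T0 (hx t tT)).
  by move=> e; exact: zX.
pose tau : R := 1 / (2 * T%:R ^+ 2).
have T20 : 0 < 2 * T%:R ^+ 2 :> R by rewrite mulr_gt0// exprn_gt0.
have tau0 : 0 < tau by rewrite divr_gt0.
have tau2 : tau <= 1 / 2.
  rewrite /tau ler_pdivrMr// mulrA (_ : 1 / 2 * 2 = 1 :> R) ?mul1r; last by field.
  by rewrite exprn_ege1 ?ler1n.
pose CR := CR_star mu.
have CRlam : CR * lam = 1 by exact: CR_starE.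
have CR0 : 0 < CR by rewrite -(pmulr_lgt0 _ lam0) CRlam.
suff main : (1 - tau) * Cost beta f E A T x <=
    (CR + tau) * Cost beta f E A T y + (1 - tau) / (4 * T%:R).
  have t1 : 0 < 1 - tau by lra.
  have -> : CR_ACORD mu T = (CR + tau) / (1 - tau) by [].
  apply: (@le_trans _ _ ((CR + tau) / (1 - tau) * Cost beta f E A T y + 1 / (4 * T%:R))).
    rewrite -(ler_pM2l t1); apply: le_trans main _; rewrite le_eqVlt.
    by apply/orP; left; apply/eqP; field; rewrite !gt_eqF.
  rewrite lerD2l ler_wpM2r ?invr_ge0 ?mulr_ge0// lerDl mulr_ge0// divr_ge0 ?sqr_ge0//.
  exact: ltW.
have objective_le t v : (1 <= t <= T)%N -> (forall i, D (v i)) ->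
    lam * round_cost beta (f t) (E t) (A t) (x t.-1) v <= G t v.
  move=> tT Dv; have := round_cost_le_objective mu beta (f t) (E t) (A t) D hN
    hbeta hmu (fun i p => f0 t i p tT) 0 v (x t.-1) _ Dv.
  by rewrite lexx ler01 subr0 addr0 !mul0r subr0 addr0 !mul1r; apply.
have phi0 : phi 0%N = 0 by rewrite /phi y0 potential_refl.
have Gy t : (1 <= t <= T)%N -> G t (y t) <= cost t y + phi t.-1.
  by move=> tT; exact: round_objective_comparator.
have [T2|T2] := ltnP T 2.
  have T1E : T = 1%N by apply/eqP; rewrite eqn_leq T0 -ltnS T2.
  have t1 : (1 <= 1 <= T)%N by rewrite T1E.
  have [g _] := gap 1%N t1.
  have := g (y 1%N) (fun i => yD _ i t1).
  have := objective_le 1%N (x 1%N) t1 (fun i => xD 1%N i T0).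
  have := Gy 1%N t1; rewrite phi0 addr0 /T4 !CostE.
  have -> : tau = 1 / 2 by rewrite /tau T1E expr1n mulr1.
  rewrite T1E !big_nat1 -/(cost 1%N x) expr1n !mul1r mulr1 => h1 h2 h3.
  have h4 : lam * cost 1%N x <= cost 1%N y + 5 / 24 * lam ^+ 2 by lra.
  have := ler_wpM2l (ltW CR0) h4.
  rewrite mulrA CRlam mul1r mulrDr (_ : CR * (5 / 24 * lam ^+ 2) = 5 / 24 * lam).
    move: Cy0; rewrite CostE T1E big_nat1 => Cy0.
    have := mulr_ge0 (ltW CR0) Cy0; lra.
  by rewrite mulrCA expr2 (mulrA CR) CRlam mul1r.
have T2R : 2 <= T%:R :> R by rewrite ler_nat.
have T44 : 4 <= T%:R ^+ 2 :> R by have := lerXn2r 2 (ler0n _ _) (ler0n R _) T2R; lra.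
have tau8 : tau <= 1 / 8.
  rewrite /tau ler_pdivrMr//; lra.
have [small|big] := leP (T4 * NM) (1 / 4 * lam ^+ 2).
  have cost_small t : (1 <= t < T.+1)%N -> T4 * (lam * cost t x) <= 11 / 24 * lam ^+ 2.
    move=> tT.
    have := round_objective_le mu beta m l (f t) (E t) (A t) (x t.-1) D X Mf Ms hN
      (hE t tT) hbeta hm hml hmu (hA' t tT) cD XD hMs (fun i => fconv t i tT)
      (fun i p => f0 t i p tT) (fun i p => fMf t i p tT)
      (fun i => xX _ i (prevT t tT)) T (xs t) (zs t) (x t) T0 (hx t tT)
      (fun e => zX t e tT).
    have /(ler_wpM2l (ltW T40)) := objective_le t (x t) tT (fun i => xD t i (andP tT).2).
    rewrite -/(cost t x) -/(G t) -/T4 -/NM -/lam; lra.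
  have C1 : T4 * (lam * Cost beta f E A T x) <= T%:R * (11 / 24 * lam ^+ 2).
    rewrite CostE !mulr_sumr; apply: le_trans (ler_sum_nat cost_small) _.
    by rewrite sumr_const_nat subSS subn0 -[leLHS]mulr_natl.
  have C2 : Cost beta f E A T x <= 1 / (4 * T%:R).
    have [C0|C0] := leP (Cost beta f E A T x) 0.
      by apply: le_trans C0 _; rewrite divr_ge0// mulr_ge0.
    have Tl : 0 < T%:R * lam by exact: mulr_gt0.
    have C3 : T%:R ^+ 2 * (T%:R * Cost beta f E A T x) <= 11 / 24 * lam.
      by rewrite -(ler_pM2l Tl); move: C1; rewrite /T4; lra.
    rewrite ler_pdivlMr ?mulr_gt0//.
    have := ler_wpM2r (ltW (mulr_gt0 Tp C0)) T44; lra.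
  have t1 : 0 <= 1 - tau by lra.
  have := ler_wpM2l t1 C2; rewrite mul1r.
  have : 0 <= (CR + tau) * Cost beta f E A T y by rewrite mulr_ge0// addr_ge0// ltW.
  lra.
have gap' t v : (1 <= t <= T)%N -> (forall i, D (v i)) ->
    T4 * (G t (x t) - G t v) <= 7 / 128 * lam ^+ 2.
  by move=> tT; have [_ []] := gap t tT; [rewrite leNgt big|exact].
(* With this theta the loss theta * phi t is at most tau times the hitting
   costs of x t and y t. *)
pose theta := lam * tau / 2.
pose eps := 7 / 32 * lam / T%:R ^+ 2.
have theta01 : 0 < theta <= 1.
  have := ler_pM (ltW lam0) (ltW tau0) lam1 tau2; have := mulr_gt0 lam0 tau0.
  by rewrite /theta => h1 h2; apply/andP; split; lra.
have epsE : eps * theta = 7 / 128 * lam ^+ 2 / T4.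
  by rewrite /eps /theta /tau /T4; field; rewrite gt_eqF.
have step t : (1 <= t <= T)%N ->
    G t (x t) - tau * F t (x t) + phi t <= (1 + tau) * cost t y + phi t.-1 + eps.
  move=> tT; have xtD i : D (x t i) by apply: xD; case/andP: tT.
  have := near_optimal_potential mu beta (f t) (E t) (A t) D hbeta cD
    (fun i => fconv t i tT) (x t.-1) (x t) (y t) theta eps theta01 xtD
    (fun i => yD t i tT).
  rewrite -/(G t) -/(phi t) epsE => h.
  have {h} : G t (x t) + (1 - theta) * phi t <= G t (y t) + eps.
    by apply: h => v Dv; rewrite ler_pdivlMr// mulrC gap'.
  have := potential_le_hitting mu (f t) D hmu cD (fun i => fconv t i tT)
    (fun i p => f0 t i p tT) (x t) (y t) xtD (fun i => yD t i tT).
  rewrite -/lam -/(phi t) -/(F t _) -/(F t _) => /(ler_wpM2l (ltW tau0)).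
  have := ler_wpM2l (ltW tau0) (costy t tT); have := Gy t tT.
  rewrite /theta; lra.
have total n : (n <= T)%N ->
    \sum_(1 <= t < n.+1) (G t (x t) - tau * F t (x t)) + phi n <=
    (1 + tau) * (\sum_(1 <= t < n.+1) cost t y) + n%:R * eps.
  elim: n => [_|n IH nT]; first by rewrite !big_geq// phi0 mulr0 mul0r.
  rewrite !(@big_nat_recr _ _ _ n.+1)//=.
  have := IH (ltnW nT); have := step n.+1 nT; rewrite /= -(natr1 n); lra.
have lower : (1 - tau) * (1 + tau) * lam * Cost beta f E A T x <=
    (1 + tau * lam) * \sum_(1 <= t < T.+1) (G t (x t) - tau * F t (x t)).
  rewrite CostE !mulr_sumr; apply: ler_sum_nat => t tT.
  apply: (round_cost_le_objective mu beta (f t) (E t) (A t) D hN hbeta hmu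
    (fun i p => f0 t i p tT)) => [|i]; first by rewrite ltW//=; lra.
  by apply: xD; case/andP: tT.
have := total T (leqnn T); rewrite -CostE => totalT.
have tl0 : 0 <= 1 + tau * lam by rewrite addr_ge0// mulr_ge0// ltW.
have phiT : 0 <= phi T by exact: potential_ge0.
have totalT' : \sum_(1 <= t < T.+1) (G t (x t) - tau * F t (x t)) <=
    (1 + tau) * Cost beta f E A T y + T%:R * eps by lra.
have upper := le_trans lower (ler_wpM2l tl0 totalT').
have p0 : 0 < (1 + tau) * lam by rewrite mulr_gt0// addr_gt0.
rewrite -(ler_pM2l p0).
have -> : (1 + tau) * lam * ((1 - tau) * Cost beta f E A T x) =
  (1 - tau) * (1 + tau) * lam * Cost beta f E A T x by ring.
apply: le_trans upper _.
have -> : T%:R * eps = 7 / 32 * lam / T%:R by rewrite /eps; field; rewrite gt_eqF.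
have -> : (1 + tau) * lam * ((CR + tau) * Cost beta f E A T y + (1 - tau) / (4 * T%:R)) =
    (1 + tau * lam) * ((1 + tau) * Cost beta f E A T y) +
    (1 + tau) * (1 - tau) / 4 * (lam / T%:R).
  transitivity ((CR * lam + tau * lam) * ((1 + tau) * Cost beta f E A T y) +
    (1 + tau) * (1 - tau) / 4 * (lam / T%:R)); last by rewrite CRlam.
  by field; rewrite gt_eqF.
rewrite mulrDr lerD2l.
have -> : (1 + tau * lam) * (7 / 32 * lam / T%:R) =
  (1 + tau * lam) * (7 / 32) * (lam / T%:R) by ring.
rewrite ler_wpM2r ?divr_ge0// ?(ltW lam0)//.
have h1 : 0 <= tau * (1 - lam) by rewrite mulr_ge0 ?subr_ge0// ltW.
have h2 : 0 <= (1 + tau) * (1 / 8 - tau) by rewrite mulr_ge0 ?subr_ge0// addr_ge0// ltW.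
lra.
Qed.
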